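(* Let $N,d,k\ge1$ be integers with $(k-1)d=2kN$, and let $1\le i<j\le k$ and $1\le \ell\le N$. Let $B$ be an $N$-parameter Brownian sheet with values in $\mathbb{R}^d$. Then $$P\bigl\{\exists(\mathbf{t}^1,\ldots,\mathbf{t}^k)\in\mathcal{H}_N^k(i,j;\ell)\text{ with } \mathbf{t}^1,\ldots,\mathbf{t}^k \text{ pairwise distinct} : B(\mathbf{t}^1)=\cdots=B(\mathbf{t}^k)\bigr\}=0.$$
   Context: An $N$-parameter Brownian sheet with values in $\mathbb{R}^d$ is a centered $\mathbb{R}^d$-valued Gaussian random field $B=(B^1,\ldots,B^d)$ with continuous sample paths, with parameter set $\mathbb{R}_+^N=[0,\infty)^N$ and covariances $\operatorname{Cov}(B^i(\mathbf{s}),B^j(\mathbf{t}))=\delta_{i,j}\prod_{\ell=1}^N (s_\ell\wedge t_\ell)$, where $\delta_{i,j}=1$ if $i=j$ and $0$ otherwise. Writing $\mathbf{t}^i=(t^i_1,\ldots,t^i_N)$, $\mathcal{H}_N^k(i,j;\ell)=\bigl\{(\mathbf{t}^1,\ldots,\mathbf{t}^k)\in\bigl((0,\infty)^N\bigr)^k : t^i_\ell=t^j_\ell\bigr\}$ is the set of $k$-tuples for which $\mathbf{t}^i$ and $\mathbf{t}^j$ share their $\ell$th coordinate. *)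

(* Defs.v *)
From mathcomp Require Import all_boot all_order all_algebra.
From mathcomp Require Import all_classical all_reals all_analysis.

Set Implicit Arguments.
Unset Strict Implicit.
Unset Printing Implicit Defensive.

Import Order.TTheory GRing.Theory Num.Theory.
Import numFieldNormedType.Exports.

Local Open Scope classical_set_scope.
Local Open Scope ring_scope.

(* [s] is a standard deviation.  The degenerate case [s = 0] is a Dirac mass:
   the library's [normal_prob m 0] is the uniform law on [0, 1] instead. *)
Definition gaussian_law (R : realType) (m s : R) : set R -> \bar R :=
  if s == 0 then \d_m else normal_prob m s.

Definition gaussian_rv (disp : measure_display) (T : measurableType disp)
    (R : realType) (P : probability T R) (X : T -> R) : Prop :=
  measurable_fun [set: T] X /\
  exists m s : R, forall A : set R, measurable A ->
    pushforward P X A = gaussian_law m s A.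

(* Joint Gaussianity of the whole family of coordinates B^i(t), t in I:
   every finite linear combination of them is Gaussian. *)
Definition gaussian_field (disp : measure_display) (T : measurableType disp)
    (R : realType) (P : probability T R) (N d : nat) (I : set 'rV[R]_N)
    (B : 'rV[R]_N -> T -> 'rV[R]_d) : Prop :=
  forall (n : nat) (t : 'I_n -> 'rV[R]_N) (a : 'I_n -> 'rV[R]_d),
    (forall p, I (t p)) ->
    gaussian_rv P (fun w => \sum_(p < n) \sum_(i < d) a p 0 i * B (t p) w 0 i).

Definition orthant (R : realType) (N : nat) : set 'rV[R]_N :=
  [set t | forall l, 0 <= t 0 l].
Arguments orthant : clear implicits.

(* [B] is total on R^N; only its values on the parameter set [orthant R N]
   are constrained. *)
Record brownian_sheet (disp : measure_display) (T : measurableType disp)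
    (R : realType) (P : probability T R) (N d : nat)
    (B : 'rV[R]_N -> T -> 'rV[R]_d) : Prop := BrownianSheet {
  sheet_gaussian : gaussian_field P (orthant R N) B ;
  sheet_centered : forall (t : 'rV[R]_N) (i : 'I_d), orthant R N t ->
    expectation P (fun w => B t w 0 i) = 0%E ;
  sheet_covariance : forall (s t : 'rV[R]_N) (i j : 'I_d),
    orthant R N s -> orthant R N t ->
    covariance P (fun w => B s w 0 i) (fun w => B t w 0 j) =
      ((i == j)%:R * \prod_(l < N) Num.min (s 0 l) (t 0 l))%:E ;
  sheet_continuous : forall w : T,
    {within orthant R N, continuous (fun t => B t w)}
}.

Definition shared_coord (R : realType) (N k : nat) (i j : 'I_k) (l : 'I_N) :
    set ('I_k -> 'rV[R]_N) :=
  [set t | (forall p q, 0 < t p 0 q) /\ t i 0 l = t j 0 l].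
Arguments shared_coord : clear implicits.

(* Main.v *)
(* Sharing a coordinate lowers the dimension of the set of parameter tuples from
   kN to kN - 1, while the probability that k pairwise distinct points of the
   sheet come within distance r of each other is of order r^((k-1)d) = r^(2kN).
   As the sheet is almost 1/2-Hoelder, about 2^(an(kN-1)) grid tuples of mesh
   2^(-an) have to be tested at distance about 2^(-bn) with b slightly less than
   a/2, and the total probability tends to 0.

   The small ball estimate is proved by Fourier analysis on the event: a
   nonnegative trigonometric polynomial which is large near 0 is integrated
   against the characteristic functions of linear combinations of coordinates,
   the only objects which joint Gaussianity gives directly.  The covariance is
   nondegenerate because a product of minima is a Gram matrix of indicator
   functions of boxes.  The Hoelder bound comes from dyadic chaining.  Uniformity
   is obtained by writing the event as a countable union over the size of the
   tuple and over the ellipticity constant of its covariance. *)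

Require Import Defs.
From HB Require Import structures.
From mathcomp Require Import all_boot all_order all_algebra.
From mathcomp Require Import all_classical all_reals all_analysis.
From mathcomp Require Import measurable_realfun.
From mathcomp Require Import ring lra zify.

Set Implicit Arguments.
Unset Strict Implicit.
Unset Printing Implicit Defensive.

Import Order.TTheory GRing.Theory Num.Theory.
Import numFieldNormedType.Exports.

Local Open Scope classical_set_scope.
Local Open Scope ring_scope.

(** * Events and union bounds *)

Section probability_bounds.
Context (disp : measure_display) (T : measurableType disp) (R : realType).
Variable P : probability T R.

(** Let b = kN for tuples of k points. As (k-1)d = 2b is critical, testing all tuples would set
    about 2^(abn) cells against a probability 2^(-2b^2 n), and the union bound diverges because the
    Hoelder estimate forces a > 2b. The shared coordinate removes a factor 2^(an), which more than
    pays for the loss in the Hoelder exponent; a = 2b + 1 keeps all scales natural powers of 2.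
    Joint Gaussianity only says that each linear combination has some normal law. Its parameters
    must be matched with the prescribed means and covariances, so the moments and the characteristic
    function of a normal law are computed, all from one integration by parts. The covariance enters
    the small ball bound only through a lower ellipticity constant, so that one constant serves all
    cells at all scales. *)

Lemma measurable_norm_le (f : T -> R) (c : R) : measurable_fun setT f ->
  measurable [set w | `|f w| <= c].
Proof.
move=> mf.
rewrite [X in measurable X](_ : _ = (fun w => `|f w|) @^-1` `]-oo, c]%classic).
  by rewrite -[X in measurable X]setTI; exact: measurableT_comp.
by apply/seteqP; split => w /=; rewrite in_itv.
Qed.

Lemma measurable_norm_ge (f : T -> R) (c : R) : measurable_fun setT f ->
  measurable [set w | c <= `|f w|].
Proof.
move=> mf.
rewrite [X in measurable X](_ : _ = (fun w => `|f w|) @^-1` `[c, +oo[%classic).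
  by rewrite -[X in measurable X]setTI; exact: measurableT_comp.
by apply/seteqP; split => w /=; rewrite in_itv/= andbT.
Qed.

Lemma measurable_forall_fin (D : finType) (A : D -> set T) : (forall x, measurable (A x)) ->
  measurable [set w | forall x, A x w].
Proof.
move=> mA; rewrite [X in measurable X](_ : _ = \bigcap_(x in [set: D]) A x).
  by apply: fin_bigcap_measurable => // x _; exact: mA.
by apply/seteqP; split => w /= h x; [move=> _|]; exact: h.
Qed.

Lemma measurable_exists_fin (I : finType) (A : I -> set T) :
  (forall x, measurable (A x)) -> measurable [set w | exists x, A x w].
Proof.
move=> mA; rewrite [X in measurable X](_ : _ = \bigcup_(x in [set: I]) A x).
  by apply: fin_bigcup_measurable => // x _; exact: mA.
by apply/seteqP; split => w /= [x]; [move=> h; exists x|move=> _ h; exists x].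
Qed.

Lemma probability_exists_le (I : finType) (A : I -> set T) (c : R) :
  (forall x, measurable (A x)) -> (forall x, (P (A x) <= c%:E)%E) ->
  (P [set w | exists x, A x w] <= (#|I|%:R * c)%:E)%E.
Proof.
move=> mA PA.
have key (s : seq I) : (P (\big[setU/set0]_(x <- s) A x) <= ((size s)%:R * c)%:E)%E.
  elim: s => [|x s IH]; first by rewrite big_nil measure0 mul0r.
  rewrite big_cons -natr1 mulrDl mul1r addrC EFinD.
  have mU : measurable (\big[setU/set0]_(y <- s) A y).
    by apply: bigsetU_measurable => y _; exact: mA.
  by apply: le_trans (@measureU2 _ _ _ P _ _ (mA x) mU) _; exact: (leeD (PA x) IH).
rewrite cardT; apply: le_trans (key (enum I)).
rewrite [X in (P X <= _)%E](_ : _ = \big[setU/set0]_(x <- enum I) A x)//.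
rewrite -bigcup_seq; apply/seteqP; split => w /= [x].
  by move=> Axw; exists x => //=; rewrite mem_enum.
by move=> _ Axw; exists x.
Qed.

Lemma probability_tail_le (A : nat -> set T) (C : R) : 0 <= C ->
  (forall j, measurable (A j)) -> (forall j, (P (A j) <= (C / 2 ^+ j)%:E)%E) ->
  forall n, (P (\bigcup_(j in [set j | (n <= j)%N]) A j) <= (2 * C / 2 ^+ n)%:E)%E.
Proof.
move=> C0 mA PA n.
rewrite [X in P X](_ : _ = \bigcup_j A (n + j)%N); last first.
  apply/seteqP; split => w /= [j nj Aj]; last by exists (n + j)%N => //=; exact: leq_addr.
  by exists (j - n)%N => //; rewrite subnKC.
have mU : measurable (\bigcup_j A (n + j)%N) by exact: bigcup_measurable.
apply: le_trans (@measure_sigma_subadditive _ _ _ P _ _ (fun j => mA (n + j)%N) mU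
  (fun w h => h)) _.
(* [epsilon_trick0] sums the weights [2^-(j + 1)], whence the factor 2. *)
apply: le_trans (@epsilon_trick0 R (2 * C / 2 ^+ n) xpredT _); last first.
  by rewrite divr_ge0 ?mulr_ge0 ?exprn_ge0.
apply: lee_nneseries => [j _ _|j _]; first exact: measure_ge0.
apply: le_trans (PA _) _; rewrite lee_fin le_eqVlt; apply/orP; left; apply/eqP.
have h (i : nat) : 2 ^+ i != 0 :> R by rewrite expf_neq0.
by rewrite natrX exprD exprS; field; rewrite !h.
Qed.

End probability_bounds.

(** * One-dimensional normal laws *)

Section normal_integrals.
Variable R : realType.
Implicit Types (m s x u : R).
Notation mu := (@lebesgue_measure R).

Lemma sqrt2_mul_neq0 s : s != 0 -> Num.sqrt 2 * s != 0.
Proof. by move=> s0; rewrite mulf_neq0// gt_eqF// sqrtr_gt0. Qed.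

Lemma normal_pdf_exp m s x : s != 0 ->
  normal_pdf m s x = normal_peak s * expR (- ((x - m) ^+ 2 / (2 * s ^+ 2))).
Proof.
move=> s0; rewrite normal_pdfE// /normal_fun; congr (_ * expR _).
by rewrite mulNr mulr_natl.
Qed.

(** Half of the exponent is set aside as a bounded factor; the other half is that of a normal
    density with twice the variance. The factor absorbs polynomial growth and also yields the tail
    bound, while the remaining density is still integrable. *)
Lemma normal_pdf_widen m s x : s != 0 ->
  normal_pdf m s x = Num.sqrt 2 * expR (- ((x - m) ^+ 2 / (4 * s ^+ 2))) *
    normal_pdf m (Num.sqrt 2 * s) x.
Proof.
move=> s0; have s20 := sqrt2_mul_neq0 s0.
have peakE : Num.sqrt 2 * normal_peak (Num.sqrt 2 * s) = normal_peak s :> R.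
  rewrite /normal_peak exprMn sqr_sqrtr//.
  have -> : (2 * s ^+ 2 * pi *+ 2 : R) = 2 * (s ^+ 2 * pi *+ 2) by ring.
  by rewrite [Num.sqrt (_ * _)]sqrtrM// invfM mulrA divff ?mul1r// gt_eqF// sqrtr_gt0.
rewrite !normal_pdf_exp// -peakE exprMn sqr_sqrtr//.
have -> : (x - m) ^+ 2 / (2 * s ^+ 2) =
   (x - m) ^+ 2 / (4 * s ^+ 2) + (x - m) ^+ 2 / (2 * (2 * s ^+ 2)) by field.
by rewrite opprD expRD; ring.
Qed.

Lemma normal_pdf_quad_le m s : s != 0 -> exists2 C, 0 <= C & forall x,
  (1 + (x - m) ^+ 2) * normal_pdf m s x <= C * normal_pdf m (Num.sqrt 2 * s) x.
Proof.
move=> s0; exists ((1 + 4 * s ^+ 2) * Num.sqrt 2).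
  by rewrite mulr_ge0// addr_ge0// mulr_ge0// sqr_ge0.
move=> x; rewrite (normal_pdf_widen _ _ s0).
set y := (x - m) ^+ 2; set q := normal_pdf _ _ _.
have s2 : 0 < s ^+ 2 by rewrite exprn_even_gt0.
(* With [y = 4 s^2 t] it remains to see [1 + 4 s^2 t <= (1 + 4 s^2) expR t], which follows from
   [1 + t <= expR t]. *)
set t := y / _; have yE : y = 4 * s ^+ 2 * t by rewrite /t; field.
have t0 : 0 <= t by rewrite /t divr_ge0 ?sqr_ge0// mulr_ge0// sqr_ge0.
rewrite [X in X <= _](_ : _ = (1 + y) * expR (- t) * (Num.sqrt 2 * q)); last by ring.
rewrite -[X in _ <= X]mulrA; apply: ler_wpM2r.
  by rewrite mulr_ge0// normal_pdf_ge0.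
rewrite expRN ler_pdivrMr ?expR_gt0// yE.
have h := expR_ge1Dx t; move: (s ^+ 2) s2 (expR t) h => v v0 e h; nra.
Qed.

Lemma integrable_normal_quad m s (K : R) (f : R -> R) : s != 0 ->
  measurable_fun setT f -> (forall x, `|f x| <= K * (1 + (x - m) ^+ 2)) ->
  mu.-integrable setT (fun x => (f x * normal_pdf m s x)%:E).
Proof.
move=> s0 mf fK; have [C C0 hC] := normal_pdf_quad_le m s0.
have K0 : 0 <= K.
  by have := fK m; rewrite subrr expr0n/= addr0 mulr1; apply: le_trans.
apply: (@le_integrable _ _ _ mu setT _ _
  (fun x => (K * C)%:E * (normal_pdf m (Num.sqrt 2 * s) x)%:E)%E) => //.
- apply/measurable_EFinP/measurable_funM => //; exact: measurable_normal_pdf.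
- move=> x _ /=; rewrite lee_fin normrM (ger0_norm (normal_pdf_ge0 _ _ _)).
  rewrite [X in _ <= X]ger0_norm ?mulr_ge0 ?normal_pdf_ge0// -[X in _ <= X]mulrA.
  apply: le_trans (ler_wpM2l K0 (hC x)); rewrite mulrA.
  by apply: ler_wpM2r; rewrite ?normal_pdf_ge0.
- by apply: integrableZl => //; exact: integrable_normal_pdf.
Qed.

(** Widening the density twice gains two quadratic factors: one pays for the growth of [f], the
    other remains as decay. *)
Lemma normal_quad_decay m s (K : R) (f : R -> R) : s != 0 ->
  (forall x, `|f x| <= K * (1 + (x - m) ^+ 2)) ->
  exists2 C, 0 <= C & forall x, `|f x * normal_pdf m s x| <= C / (1 + (x - m) ^+ 2).
Proof.
move=> s0 fK; have s20 := sqrt2_mul_neq0 s0.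
have [C C0 hC] := normal_pdf_quad_le m s0.
have [D D0 hD] := normal_pdf_quad_le m s20.
have K0 : 0 <= K.
  by have := fK m; rewrite subrr expr0n/= addr0 mulr1; apply: le_trans.
pose p := normal_peak (Num.sqrt 2 * (Num.sqrt 2 * s)).
exists (K * C * D * p).
  by rewrite !mulr_ge0// /p ?normal_peak_ge0.
move=> x; have q0 : 0 < 1 + (x - m) ^+ 2 by rewrite ltr_wpDr// sqr_ge0.
rewrite ler_pdivlMr// normrM (ger0_norm (normal_pdf_ge0 _ _ _)).
apply: le_trans (_ : K * (1 + (x - m) ^+ 2) * normal_pdf m s x * (1 + (x - m) ^+ 2) <= _).
  by rewrite ler_wpM2r ?(ltW q0)// ler_wpM2r ?normal_pdf_ge0.
rewrite -!mulrA; apply: ler_wpM2l => //.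
rewrite mulrA [X in X <= _]mulrC.
apply: le_trans (ler_wpM2l (ltW q0) (hC x)) _.
rewrite mulrCA; apply: ler_wpM2l => //; apply: le_trans (hD x) _.
by apply: ler_wpM2l => //; apply: normal_pdf_ub; exact: sqrt2_mul_neq0.
Qed.

Lemma integral_derive_eq0 (F f : R -> R) :
  (forall x, is_derive x 1 F (f x)) -> continuous f ->
  mu.-integrable setT (EFin \o f) ->
  F n%:R @[n --> \oo] --> 0 -> F (- n%:R) @[n --> \oo] --> 0 ->
  \int[mu]_x f x = 0.
Proof.
move=> dF cf intf Fy FNy.
have mf : measurable_fun setT f by exact: continuous_measurable_fun.
have cF : continuous F.
  move=> x; apply/differentiable_continuous/derivable1_diffP.
  by have [] := dF x.
(* On [[-n, n]] the fundamental theorem leaves boundary terms that tend to 0; dominated convergence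
   removes the truncation. *)
pose fn (n : nat) := (EFin \o f) \_ (`[- n%:R, n%:R] : set R).
have mfn n : measurable_fun setT (fn n).
  apply/(measurable_restrictT _ _).1 => //.
  by apply: measurable_funTS; exact/measurable_EFinP.
have mEf : measurable_fun setT (EFin \o f) by exact/measurable_EFinP.
have fnf : {ae mu, forall x, setT x -> fn ^~ x @ \oo --> (EFin \o f) x}.
  apply: aeW => x _; apply: cvg_near_cst; near=> n.
  rewrite /fn patchE mem_set//= in_itv/= -ler_norml.
  by near: n; exact: nbhs_infty_ger.
have fng : {ae mu, forall x n, setT x ->
    (`|fn n x| <= (abse \o (EFin \o f)) x)%E}.
  apply: aeW => x n _; rewrite /fn patchE; case: ifPn => // _.
  by rewrite abse0 abse_ge0.
have [_ _ lim1] := @dominated_convergence _ _ _ mu setT measurableT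
  fn (EFin \o f) (abse \o (EFin \o f)) mfn mEf fnf (integrable_abse intf) fng.
have lim2 : [sequence (\int[mu]_x fn n x)%E]_n @ \oo --> 0%E.
  have -> : [sequence (\int[mu]_x fn n x)%E]_n = (fun n => (F n%:R - F (- n%:R))%:E).
    apply/funext => n /=; rewrite -integral_mkcond.
    (* The fundamental theorem needs a nondegenerate interval, so [n = 0] is separate. *)
    case: n => [|n].
      by rewrite oppr0 subrr set_itv1 integral_set1.
    rewrite (@continuous_FTC2 _ f F) ?EFinB//.
    + by rewrite gtrN ?ltr0n.
    + exact: continuous_subspaceT.
    + split.
      * by move=> x _; have [] := dF x.
      * by apply: cvg_at_right_filter; exact: cF.
      * by apply: cvg_at_left_filter; exact: cF.
    + by move=> x _; rewrite derive1E; have [_ ->] := dF x.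
  apply: cvg_EFin; first exact: nearW.
  rewrite -[X in _ --> X]subr0; exact: cvgB.
by rewrite /Rintegral (cvg_unique _ lim1 lim2).
Unshelve. all: by end_near. Qed.

End normal_integrals.

(** * Integration by parts, moments and characteristic function of a normal law *)

Section normal_stein.
Variable R : realType.
Implicit Types (m s x u : R).
Notation mu := (@lebesgue_measure R).

Lemma is_derive_normal_pdf m s x : s != 0 ->
  is_derive x 1 (normal_pdf m s) (- ((x - m) / s ^+ 2) * normal_pdf m s x).
Proof.
move=> s0; pose c : R := - (2 * s ^+ 2)^-1.
have -> : normal_pdf m s =
    normal_peak s *: (expR \o (c *: (@idfun R - cst m) ^+ 2)).
  apply/funext => y; rewrite normal_pdf_exp// /c !fctE /=.
  by congr (_ * expR _); rewrite /= -[RHS]/(_ * _) mulNr mulrC.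
apply: is_derive_eq; rewrite /c !fctE/= /GRing.scale/=; field.
by rewrite s0.
Qed.

Lemma linear_bound_quad m (K : R) (f : R -> R) :
  (forall x, `|f x| <= K * (1 + `|x - m|)) ->
  forall x, `|f x| <= (2 * K) * (1 + (x - m) ^+ 2).
Proof.
move=> fK x; have K0 : 0 <= K.
  by have := fK m; rewrite subrr normr0 addr0 mulr1; apply: le_trans.
apply: le_trans (fK x) _; rewrite -[_ ^+ 2]real_normK ?num_real//.
rewrite [2 * K]mulrC -mulrA; apply: ler_wpM2l => //.
by move: (`|x - m|) (normr_ge0 (x - m)) => a a0; nra.
Qed.

Lemma cvg_quad_decay (m C : R) (g : nat -> R) (F : R -> R) :
  (forall x, `|F x| <= C / (1 + (x - m) ^+ 2)) ->
  (forall n : nat, n%:R - `|m| <= `|g n - m|) ->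
  F (g n) @[n --> \oo] --> 0.
Proof.
move=> FC gm.
have C0 : 0 <= C.
  by have := FC m; rewrite subrr expr0n/= addr0 divr1; apply: le_trans.
apply/cvgrPdist_le => e e0; near=> n; rewrite sub0r normrN.
apply: le_trans (FC _) _.
have q0 : 0 < 1 + (g n - m) ^+ 2 by rewrite ltr_wpDr// sqr_ge0.
rewrite ler_pdivrMr//.
have h : C / e + 1 + `|m| <= n%:R by near: n; exact: nbhs_infty_ger.
have h2 := gm n.
have Ce : 0 <= C / e by rewrite divr_ge0// ltW.
have : C / e + 1 <= `|g n - m| by lra.
rewrite -[(g n - m) ^+ 2]real_normK ?num_real//.
have key (c a : R) : 0 <= c -> c + 1 <= a -> c <= 1 + a ^+ 2 by nra.
by move=> /(key _ _ Ce); rewrite ler_pdivrMr// mulrC.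
Unshelve. all: by end_near. Qed.

(* The derivative of [h * normal_pdf m s] integrates to 0. *)
Lemma normal_stein m s (K : R) (h h' : R -> R) : s != 0 ->
  (forall x, is_derive x 1 h (h' x)) -> continuous h' ->
  (forall x, `|h x| <= K * (1 + `|x - m|)) -> (forall x, `|h' x| <= K) ->
  s ^+ 2 * (\int[mu]_x (h' x * normal_pdf m s x)) =
  \int[mu]_x (h x * (x - m) * normal_pdf m s x).
Proof.
move=> s0 dh ch' hK h'K.
have s20 : s ^+ 2 != 0 by rewrite expf_neq0.
have K0 : 0 <= K by apply: le_trans (h'K 0).
have ch : continuous h.
  by move=> x; apply/differentiable_continuous/derivable1_diffP; have [] := dh x.
have chm : continuous (fun x => h x * (x - m)).
  move=> x; apply: cvgM; first exact: ch.
  by apply: cvgB; [exact: cvg_id|exact: cvg_cst].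
have int1 : mu.-integrable setT (fun x => (h' x * normal_pdf m s x)%:E).
  apply: (@integrable_normal_quad R m s K) => //.
    exact: continuous_measurable_fun.
  move=> x; apply: le_trans (h'K x) _.
  by rewrite ler_peMr// lerDl sqr_ge0.
have int2 : mu.-integrable setT (fun x => (h x * (x - m) * normal_pdf m s x)%:E).
  apply: (@integrable_normal_quad R m s (2 * K)) => //.
    exact: continuous_measurable_fun.
  move=> x; rewrite normrM -[(x - m) ^+ 2]real_normK ?num_real//.
  have key (a : R) : (1 + a) * a <= 2 * (1 + a ^+ 2) by nra.
  apply: le_trans (ler_wpM2r (normr_ge0 _) (hK x)) _.
  by rewrite [2 * K]mulrC -!mulrA; exact: ler_wpM2l (key _).
have int3 : mu.-integrable setT
    (fun x => (s ^- 2 * (h x * (x - m) * normal_pdf m s x))%:E).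
  by under eq_fun do rewrite EFinM; exact: integrableZl.
have [C C0 hC] := normal_quad_decay s0 (linear_bound_quad hK).
have : \int[mu]_x (h' x * normal_pdf m s x -
    s ^- 2 * (h x * (x - m) * normal_pdf m s x)) = 0.
  apply: (@integral_derive_eq0 R (fun x => h x * normal_pdf m s x)).
  - move=> x; have d1 := is_derive_normal_pdf m x s0; have d2 := dh x.
    rewrite -[X in is_derive _ _ X _]/(h * normal_pdf m s).
    by apply: is_derive_eq; rewrite /GRing.scale/=; field.
  - move=> x; apply: cvgB; first by apply: cvgM; [exact: ch'|exact: continuous_normal_pdf].
    apply: cvgM; first exact: cvg_cst.
    by apply: cvgM; [exact: chm|exact: continuous_normal_pdf].
  - rewrite /comp; under eq_fun do rewrite EFinB.
    exact: integrableB.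
  - apply: (cvg_quad_decay hC) => n.
    by have := ler_norm m; have := ler_norm (n%:R - m); lra.
  - apply: (cvg_quad_decay hC) => n.
    by have := ler_norm (- m); rewrite normrN; have := ler_norm (- (- n%:R - m)); rewrite normrN; lra.
rewrite RintegralB//= RintegralZl// => /eqP; rewrite subr_eq0 => /eqP ->.
by rewrite mulrA divff// mul1r.
Qed.

Lemma Rintegral_normal_pdf m s : \int[mu]_x normal_pdf m s x = 1.
Proof. by rewrite /Rintegral integral_normal_pdf. Qed.

(** Instance [h = 1] of [normal_stein]; [h x = x - m] will give the variance, and
    [h x = sin (u * x)] the differential equation of the characteristic function. *)
Lemma normal_mean0 m s : s != 0 -> \int[mu]_x ((x - m) * normal_pdf m s x) = 0.
Proof.
move=> s0.
have H : s ^+ 2 * (\int[mu]_x (0 * normal_pdf m s x)) =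
    \int[mu]_x (1 * (x - m) * normal_pdf m s x).
  apply: (@normal_stein m s 1 (fun=> 1) (fun=> 0)) => //.
  - by move=> x; exact: cst_continuous.
  - by move=> x; rewrite normr1 mul1r lerDl.
  - by move=> x; rewrite normr0.
under eq_Rintegral do rewrite -[X in X * _]mul1r; rewrite -H.
by under eq_Rintegral do rewrite mul0r; rewrite Rintegral_cst// mul0r mulr0.
Qed.

Lemma normal_var m s : s != 0 ->
  \int[mu]_x ((x - m) ^+ 2 * normal_pdf m s x) = s ^+ 2.
Proof.
move=> s0.
have H : s ^+ 2 * (\int[mu]_x (1 * normal_pdf m s x)) =
    \int[mu]_x ((x - m) * (x - m) * normal_pdf m s x).
  apply: (@normal_stein m s 1 (fun x => x - m) (fun=> 1)) => //.
  - move=> x; have := is_deriveB (is_derive_id x (1 : R)) (is_derive_cst m x (1 : R)).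
    by rewrite subr0.
  - by move=> x; exact: cst_continuous.
  - by move=> x; rewrite mul1r lerDr.
  - by move=> x; rewrite normr1.
under eq_Rintegral do rewrite expr2; rewrite -H.
by under eq_Rintegral do rewrite mul1r; rewrite Rintegral_normal_pdf mulr1.
Qed.

(** By symmetry of the centered law the sine part vanishes, so the cosine integral is the whole
    characteristic function. *)
Let charf s u := \int[mu]_x (cos (u * x) * normal_pdf 0 s x).

Let integrable_bounded s (f : R -> R) : continuous f -> (forall x, `|f x| <= 1) ->
  mu.-integrable setT (fun x => (f x * normal_pdf 0 s x)%:E).
Proof.
move=> cf f1; under eq_fun do rewrite EFinM.
apply: integrableMr => //; last exact: integrable_normal_pdf.
  exact: continuous_measurable_fun.
by exists 1; split => // y y1 x _ /=; exact: le_trans (f1 x) (ltW y1).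
Qed.

Let continuous_cosu u : continuous (fun x : R => cos (u * x)).
Proof.
move=> x; apply: (@continuous_comp _ _ _ (fun x => u * x) (@cos R)).
  by apply: cvgM; [exact: cvg_cst|exact: cvg_id].
exact: continuous_cos.
Qed.

Let continuous_sinu u : continuous (fun x : R => sin (u * x)).
Proof.
move=> x; apply: (@continuous_comp _ _ _ (fun x => u * x) (@sin R)).
  by apply: cvgM; [exact: cvg_cst|exact: cvg_id].
exact: continuous_sin.
Qed.

Let is_derive_cosu (x u : R) : is_derive u 1 (fun v => cos (v * x)) (- (x * sin (u * x))).
Proof.
have d : is_derive u 1 (x *: @idfun R) x.
  by apply: is_derive_eq; rewrite /GRing.scale/= mulr1.
have e : (fun v => cos (v * x)) = @cos R \o (x *: @idfun R).
  by apply/funext => v /=; rewrite !fctE /GRing.scale/= mulrC.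
rewrite e; apply: is_derive_eq; rewrite !fctE /GRing.scale/= [x * u]mulrC.
by ring.
Qed.

(** Differentiation under the integral produces [- x sin (u x)], which [normal_stein] turns back
    into a cosine. *)
Let is_derive_charf s u : s != 0 ->
  is_derive u 1 (charf s) (- (s ^+ 2 * u * charf s u)).
Proof.
move=> s0.
pose f u x := cos (u * x) * normal_pdf 0 s x.
have Iu : `](u - 1), (u + 1)[%classic u by rewrite /= in_itv/= ltrBlDr ltrDl ltr01.
have intf v : mu.-integrable setT (EFin \o f v).
  by apply: integrable_bounded; [exact: continuous_cosu|move=> x; exact: cos_max].
have derf (v y : R) : is_derive v 1 (f ^~ y) (- (y * sin (v * y)) * normal_pdf 0 s y).
  have := is_deriveM (is_derive_cosu y v) (is_derive_cst (normal_pdf 0 s y) v (1 : R)).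
  move=> h; apply: (@is_derive_eq _ _ _ _ _ _ _ _ h).
  by rewrite /GRing.scale/= mulr0 add0r mulrC.
have derf' (v y : R) : derivable (f ^~ y) v 1 by have [] := derf v y.
have d1E (v y : R) : partial1of2 f v y = - (y * sin (v * y)) * normal_pdf 0 s y.
  by rewrite partial1of2E; have [_ ->] := derf v y.
have key : forall x, `|x| <= 2 * 1 * (1 + (x - 0) ^+ 2) :> R.
  by apply: linear_bound_quad => x; rewrite mul1r subr0 lerDr.
pose G (y : R) : R := `|y| * normal_pdf 0 s y.
have G0 (y : R) : 0 <= G y by rewrite mulr_ge0// normal_pdf_ge0.
have intG : mu.-integrable setT (EFin \o G).
  apply: (@integrable_normal_quad _ _ _ (2 * 1)) => // x.
  by rewrite normr_id; exact: key.
have Gub (v y : R) : `](u - 1), (u + 1)[%classic v -> setT y -> `|partial1of2 f v y| <= G y.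
  move=> _ _; rewrite d1E normrM (ger0_norm (normal_pdf_ge0 _ _ _)) normrN normrM.
  by apply: ler_wpM2r; [exact: normal_pdf_ge0|rewrite ler_piMr// sin_max].
have dd := @differentiation_under_integral _ _ _ mu f setT measurableT u (u - 1)
  (u + 1) Iu (fun v _ => intf v) (fun v y _ _ => derf' v y) G G0 intG Gub.
have dd' := @derivable_under_integral _ _ _ mu f setT measurableT u (u - 1)
  (u + 1) Iu (fun v _ => intf v) (fun v y _ _ => derf' v y) G G0 intG Gub.
apply: DeriveDef => //; rewrite -derive1E; apply: etrans dd _.
under eq_Rintegral do rewrite d1E.
have H : s ^+ 2 * (\int[mu]_x (u * cos (u * x) * normal_pdf 0 s x)) =
    \int[mu]_x (sin (u * x) * (x - 0) * normal_pdf 0 s x).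
  (* The maximum bounds both [sin (u x)] and its derivative [u cos (u x)]. *)
  apply: (@normal_stein 0 s (Num.max 1 `|u|)) => //.
  - move=> x; have d : is_derive x 1 (u *: @idfun R) u.
      by apply: is_derive_eq; rewrite /GRing.scale/= mulr1.
    rewrite [X in is_derive _ _ X _](_ : _ = @sin R \o (u *: @idfun R)); last first.
      by apply/funext => v /=; rewrite !fctE /GRing.scale.
    by apply: is_derive_eq; rewrite !fctE /GRing.scale/= mulrC.
  - by move=> x; apply: cvgM; [exact: cvg_cst|exact: continuous_cosu].
  - move=> x; apply: le_trans (sin_max _) _.
    by rewrite -[leLHS]mul1r ler_pM// ?le_max ?lexx// lerDl.
  - move=> x; rewrite normrM -[leRHS]mulr1 ler_pM//; last exact: cos_max.
    by rewrite le_max lexx orbT.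
have intcos : mu.-integrable setT (fun x => (cos (u * x) * normal_pdf 0 s x)%:E).
  by apply: integrable_bounded; [exact: continuous_cosu|move=> x; exact: cos_max].
have intsin : mu.-integrable setT (fun x => (sin (u * x) * (x - 0) * normal_pdf 0 s x)%:E).
  apply: (@integrable_normal_quad _ _ _ (2 * 1)) => //.
    apply: continuous_measurable_fun => x; apply: cvgM; first exact: continuous_sinu.
    by apply: cvgB; [exact: cvg_id|exact: cvg_cst].
  move=> x; rewrite normrM [X in _ * X](_ : _ = `|x|) ?subr0//.
  apply: (@le_trans _ _ `|x|); first by rewrite ler_piMl// sin_max.
  by have := key x; rewrite subr0.
transitivity (- \int[mu]_x (sin (u * x) * (x - 0) * normal_pdf 0 s x)).
  rewrite -mulN1r -RintegralZl//; apply: eq_Rintegral => x _.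
  by rewrite subr0; ring.
rewrite -H /charf -mulrA -[in RHS]RintegralZl//; congr (- (_ * _)).
by apply: eq_Rintegral => x _; rewrite mulrA.
Qed.

(** The differential equation makes [g], the quotient of [charf] by the claimed value, constant; at
    0 it is the total mass 1. *)
Lemma normal_charf s u : s != 0 ->
  \int[mu]_x (cos (u * x) * normal_pdf 0 s x) = expR (- (s ^+ 2 * u ^+ 2 / 2)).
Proof.
move=> s0; pose g v := charf s v * expR (s ^+ 2 * v ^+ 2 / 2).
have dg (v : R) : is_derive v 1 g 0.
  have d2 : is_derive v 1 (fun v => expR (s ^+ 2 * v ^+ 2 / 2))
      (s ^+ 2 * v * expR (s ^+ 2 * v ^+ 2 / 2)).
    rewrite [X in is_derive _ _ X _](_ : _ =
      @expR R \o ((s ^+ 2 / 2) *: (@idfun R ^+ 2))); last first.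
      by apply/funext => x /=; rewrite !fctE /GRing.scale/=; congr expR; ring.
    apply: is_derive_eq; rewrite !fctE /GRing.scale/= mulrC; congr (_ * expR _).
      by field.
    by ring.
  have := is_deriveM (is_derive_charf v s0) d2; rewrite -/g => h.
  apply: (@is_derive_eq _ _ _ _ _ _ _ _ h).
  by rewrite /GRing.scale/=; ring.
have := is_derive_0_is_cst u 0 dg.
rewrite /g [s ^+ 2 * 0 ^+ 2]mulrC expr0n/= !mul0r expR0 mulr1.
have -> : charf s 0 = 1.
  rewrite /charf; under eq_Rintegral do rewrite mul0r cos0 mul1r.
  exact: Rintegral_normal_pdf.
move=> h; rewrite -[LHS]/(charf s u) expRN.
by rewrite -[LHS](mulfK (lt0r_neq0 (expR_gt0 (s ^+ 2 * u ^+ 2 / 2)))) h mul1r.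
Qed.

End normal_stein.

(** * Expectations of functions of a Gaussian variable *)

Section gaussian_laws.
Context (disp : measure_display) (T : measurableType disp) (R : realType).
Variable P : probability T R.
Notation mu := (@lebesgue_measure R).

(** The change of variables involves a Radon-Nikodym derivative. It agrees almost everywhere with
    [normal_pdf], since both have the same integral over every measurable set. *)
Lemma ge0_integral_normal_prob (m s : R) (f : R -> \bar R) :
  measurable_fun setT f -> (forall x, (0 <= f x)%E) ->
  (\int[normal_prob m s]_x f x = \int[mu]_x (f x * (normal_pdf m s x)%:E))%E.
Proof.
move=> mf f0.
have dom := normal_prob_dominates m s.
rewrite -(Radon_Nikodym_SigmaFinite.change_of_variables dom f0 measurableT mf).
have mRN : mu.-integrable setT (Radon_Nikodym_SigmaFinite.f (normal_prob m s) mu).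
  exact: Radon_Nikodym_SigmaFinite.f_integrable.
apply: ae_eq_integral => //.
- apply: emeasurable_funM => //; exact: measurable_int mRN.
- apply: emeasurable_funM => //; apply/measurable_EFinP.
  exact: measurable_normal_pdf.
- apply: ae_eqe_mul2l => /=; apply: integral_ae_eq => //.
  + by apply/measurable_EFinP; exact: measurable_normal_pdf.
  + by move=> E _ mE; rewrite -Radon_Nikodym_SigmaFinite.f_integral.
Qed.

Lemma integral_normal_prob (m s : R) (f : R -> \bar R) :
  (normal_prob m s).-integrable setT f ->
  (\int[normal_prob m s]_x f x = \int[mu]_x (f x * (normal_pdf m s x)%:E))%E.
Proof.
move=> intf; have mf := measurable_int _ intf.
rewrite -(Radon_Nikodym_change_of_variables (normal_prob_dominates m s))//=.
apply: ae_eq_integral => //.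
- apply: emeasurable_funM => //; apply: (measurable_int mu).
  by apply: Radon_Nikodym_integrable; exact: normal_prob_dominates.
- apply: emeasurable_funM => //; apply/measurable_EFinP.
  exact: measurable_normal_pdf.
- apply: ae_eqe_mul2l => /=.
  rewrite Radon_NikodymE//=; first exact: normal_prob_dominates.
  move=> dom; case: cid => /= h [h1 h2 h3]; apply: integral_ae_eq => //=.
  + by apply/measurable_EFinP; exact: measurable_normal_pdf.
  + by move=> E _ mE; rewrite -h3.
Qed.

Section normal_variable.
Variables (X : {RV P >-> measurableTypeR R}) (m s : R).
Hypothesis s0 : s != 0.
Hypothesis law : forall A, measurable A -> pushforward P X A = gaussian_law m s A.

Lemma ge0_expectation_normal (f : R -> R) :
  measurable_fun setT f -> (forall x, 0 <= f x) ->
  (\int[P]_w (f (X w))%:E = \int[mu]_x (f x * normal_pdf m s x)%:E)%E.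
Proof.
move=> mf f0; have mEf : measurable_fun setT (EFin \o f) by exact/measurable_EFinP.
transitivity (\int[distribution P X]_y (EFin \o f) y)%E.
  by rewrite ge0_integral_distribution// => y; rewrite lee_fin.
under [RHS]eq_integral do rewrite EFinM.
rewrite -(ge0_integral_normal_prob _ _ mEf) => [|y]; last by rewrite lee_fin f0.
apply: eq_measure_integral => A mA _.
by have := law mA; rewrite /gaussian_law (negbTE s0).
Qed.

(** Quadratic growth covers the functions needed below: affine functions, the square and the
    cosine. *)
Lemma expectation_normal (K : R) (f : R -> R) :
  measurable_fun setT f -> (forall x, `|f x| <= K * (1 + (x - m) ^+ 2)) ->
  P.-integrable setT (fun w => (f (X w))%:E) /\
  (\int[P]_w (f (X w))%:E = (\int[mu]_x (f x * normal_pdf m s x))%:E)%E.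
Proof.
move=> mf fK; have ifp := integrable_normal_quad s0 mf fK.
have mEf : measurable_fun setT (EFin \o f) by exact/measurable_EFinP.
have mnf : measurable_fun setT (fun x => `|f x|) by exact: measurableT_comp.
have fin : (\int[mu]_x (`|f x| * normal_pdf m s x)%:E < +oo)%E.
  move/integrableP: ifp => [_]; apply: le_lt_trans.
  rewrite le_eqVlt; apply/orP; left; apply/eqP; apply: eq_integral => x _.
  by rewrite abse_EFin normrM (ger0_norm (normal_pdf_ge0 _ _ _)).
have int : P.-integrable setT (fun w => (f (X w))%:E).
  apply/integrableP; split.
    by apply/measurable_EFinP; exact: measurableT_comp.
  under eq_integral do rewrite abse_EFin.
  by rewrite (ge0_expectation_normal (f := fun x => `|f x|)).
have intn : (normal_prob m s).-integrable setT (EFin \o f).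
  apply/integrableP; split => //; apply: le_lt_trans fin.
  rewrite (@ge0_integral_normal_prob m s (abse \o (EFin \o f))) => [//||x].
    exact: measurableT_comp.
  exact: abse_ge0.
split => //; rewrite /Rintegral fineK; last exact: integrable_fin_num ifp.
transitivity (\int[distribution P X]_y (EFin \o f) y)%E.
  by rewrite integral_distribution.
under [RHS]eq_integral do rewrite EFinM.
rewrite -(integral_normal_prob intn).
apply: eq_measure_integral => A mA _.
by have := law mA; rewrite /gaussian_law (negbTE s0).
Qed.

End normal_variable.

Lemma expectation_dirac (X : {RV P >-> measurableTypeR R}) (m : R) (f : R -> R) :
  (forall A, measurable A -> pushforward P X A = gaussian_law m 0 A) ->
  measurable_fun setT f ->
  P.-integrable setT (fun w => (f (X w))%:E) /\
  (\int[P]_w (f (X w))%:E = (f m)%:E)%E.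
Proof.
rewrite /gaussian_law eqxx => law mf.
have ge0 (g : R -> R) : measurable_fun setT g -> (forall x, 0 <= g x) ->
    (\int[P]_w (g (X w))%:E = (g m)%:E)%E.
  move=> mg g0; have mEg : measurable_fun setT (EFin \o g) by exact/measurable_EFinP.
  transitivity (\int[distribution P X]_y (EFin \o g) y)%E.
    by rewrite ge0_integral_distribution// => y; rewrite lee_fin.
  transitivity (\int[\d_(m : measurableTypeR R)]_y (EFin \o g) y)%E.
    by apply: eq_measure_integral => A mA _; exact: law.
  by rewrite integral_dirac//= diracT mul1e.
have mEf : measurable_fun setT (EFin \o f) by exact/measurable_EFinP.
have int : P.-integrable setT (fun w => (f (X w))%:E).
  apply/integrableP; split.
    by apply/measurable_EFinP; exact: measurableT_comp.
  under eq_integral do rewrite abse_EFin.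
  by rewrite (ge0 (fun x => `|f x|)) ?ltry//; exact: measurableT_comp.
split => //; transitivity (\int[distribution P X]_y (EFin \o f) y)%E.
  by rewrite integral_distribution.
transitivity (\int[\d_(m : measurableTypeR R)]_y (EFin \o f) y)%E.
  by apply: eq_measure_integral => A mA _; exact: law.
by rewrite integral_dirac//= diracT mul1e.
Qed.

Lemma gaussian_rv_integrable (X : T -> R) : gaussian_rv P X ->
  P.-integrable setT (EFin \o X).
Proof.
move=> [mX [m [s law]]].
have mX' : @measurable_fun _ _ T (measurableTypeR R) setT X by exact: mX.
pose X' : {RV P >-> measurableTypeR R} :=
  HB.pack (X : T -> measurableTypeR R) (isMeasurableFun.Build _ _ _ (measurableTypeR R) _ mX').
have [s0|s0] := eqVneq s 0.
  by rewrite s0 in law; have [] := @expectation_dirac X' m (fun x => x) law.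
have key x : `|x| <= (2 + 2 * `|m|) * (1 + (x - m) ^+ 2).
  have := ler_normD (x - m) m; rewrite subrK.
  rewrite -[(x - m) ^+ 2]real_normK ?num_real//.
  have key2 (a b : R) : 0 <= a -> 0 <= b -> a + b <= (2 + 2 * b) * (1 + a ^+ 2).
    by move=> a0 b0; have := mulr_ge0 b0 (sqr_ge0 a); have := sqr_ge0 (a - 1); nra.
  by move/le_trans; apply; exact: key2.
by have [] := @expectation_normal X' m s s0 law _ (fun x => x) _ key.
Qed.

Lemma gaussian_rv_centered (X : T -> R) : gaussian_rv P X ->
  (\int[P]_w (X w)%:E = 0)%E ->
  exists2 s, measurable_fun setT X &
    forall A, measurable A -> pushforward P X A = gaussian_law 0 s A.
Proof.
move=> [mX [m [s law]]] E0; exists s => //; suff -> : 0 = m by [].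
have mX' : @measurable_fun _ _ T (measurableTypeR R) setT X by exact: mX.
pose X' : {RV P >-> measurableTypeR R} :=
  HB.pack (X : T -> measurableTypeR R) (isMeasurableFun.Build _ _ _ (measurableTypeR R) _ mX').
have [s0|s0] := eqVneq s 0.
  rewrite s0 in law; have [//|_] := @expectation_dirac X' m (fun x => x) law.
  by rewrite E0 => -[].
have key : forall x, `|x - m| <= 2 * 1 * (1 + (x - m) ^+ 2).
  by apply: linear_bound_quad => x; rewrite mul1r lerDr.
have [|int E1] := @expectation_normal X' m s s0 law (2 * 1) (fun x => x - m) _ key.
  exact: measurable_funB.
have intX := gaussian_rv_integrable (conj mX (ex_intro _ m (ex_intro _ s law))).
move: E1; rewrite normal_mean0//.
under eq_integral do rewrite EFinB.
rewrite integralB//=; last exact: finite_measure_integrable_cst.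
rewrite [X in (X - _)%E]E0 integral_cst//= probability_setT mule1 sub0e => -[].
by move/eqP; rewrite oppr_eq0 => /eqP.
Qed.

(* The tail is stated with an upper bound [u > 0] of the variance [v], because
   [x ^+ 2 / (4 * v)] is 0 when [v = 0]. *)
Lemma gaussian_rv_laws (X : T -> R) : gaussian_rv P X ->
  (\int[P]_w (X w)%:E = 0)%E ->
  exists2 v, 0 <= v & [/\ P.-integrable setT (fun w => (X w ^+ 2)%:E),
    (\int[P]_w (X w ^+ 2)%:E = v%:E)%E,
    (\int[P]_w (cos (X w))%:E = (expR (- (v / 2)))%:E)%E &
    forall u x : R, v <= u -> 0 < u -> 0 < x -> (P [set w | (x <= `|X w|)%R] <=
      (Num.sqrt 2 * expR (- (x ^+ 2 / (4 * u))))%:E)%E].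
Proof.
move=> gX E0; have [s mX law] := gaussian_rv_centered gX E0.
have mX' : @measurable_fun _ _ T (measurableTypeR R) setT X by exact: mX.
pose X' : {RV P >-> measurableTypeR R} :=
  HB.pack (X : T -> measurableTypeR R) (isMeasurableFun.Build _ _ _ (measurableTypeR R) _ mX').
have msq : measurable_fun setT (fun x : R => x ^+ 2) by exact: measurable_funX.
have mcos : measurable_fun setT (@cos R).
  by apply: continuous_measurable_fun; exact: continuous_cos.
have mA (x : R) : measurable [set y : R | x <= `|y|].
  by exact: (@measurable_norm_ge _ _ R idfun x (@measurable_id _ _ setT)).
have PA x : P [set w | x <= `|X w|] =
    (\int[P]_w (\1_[set y : R | (x <= `|y|)%R] (X w))%:E)%E.
  rewrite -[LHS]/(P (X @^-1` [set y : R | x <= `|y|])).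
  rewrite -[X @^-1` _]setIT -integral_indic//.
  by rewrite -[X in measurable X]setTI; exact: mX.
exists (s ^+ 2); first exact: sqr_ge0.
have [s0|s0] := eqVneq s 0.
  move: law; rewrite s0 expr0n/= => law.
  have dir f (mf : measurable_fun setT f) := @expectation_dirac X' 0 f law mf.
  have [i1 e1] := dir _ msq; have [_ e2] := dir _ mcos.
  split => //.
  - by rewrite e1 expr0n.
  - by rewrite e2 cos0 mul0r oppr0 expR0.
  - move=> u x _ _ x0; rewrite PA (dir (\1_[set y : R | x <= `|y|]) _).2; last exact: measurable_indic.
    rewrite indicE memNset/=; last by rewrite normr0 leNgt x0.
    by rewrite lee_fin mulr_ge0 ?expR_ge0.
have nor f (mf : measurable_fun setT f) :=
  @expectation_normal X' 0 s s0 law 1 f mf.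
have [|i1 e1] := nor _ msq.
  by move=> x; rewrite mul1r subr0 ger0_norm ?sqr_ge0// lerDr.
have [|_ e2] := nor _ mcos.
  by move=> x; rewrite mul1r (le_trans (cos_max _))// lerDl sqr_ge0.
split => //.
- rewrite e1; congr EFin; rewrite -[RHS](@normal_var R 0)//.
  by apply: eq_Rintegral => x _; rewrite subr0.
- rewrite e2; congr EFin.
  have := normal_charf 1 s0; rewrite expr1n mulr1 => <-.
  by apply: eq_Rintegral => x _; rewrite mul1r.
move=> u x su u0 x0; rewrite PA (@ge0_expectation_normal X' 0 s s0 law)//.
(* After [normal_pdf_widen], the exponential factor is at most [expR (- (x^2 / (4 u)))] where
   [x <= |y|], and the remaining density has total mass 1. *)
pose q y := Num.sqrt 2 * expR (- (x ^+ 2 / (4 * u))) * normal_pdf 0 (Num.sqrt 2 * s) y.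
apply: (@le_trans _ _ (\int[mu]_y (q y)%:E)%E).
  apply: ge0_le_integral => //.
  - by move=> y _; rewrite lee_fin mulr_ge0 ?normal_pdf_ge0.
  - apply/measurable_EFinP/measurable_funM.
      by apply: measurable_indic; exact: (mA x).
    exact: measurable_normal_pdf.
  - by apply/measurable_EFinP/measurable_funM => //; exact: measurable_normal_pdf.
  move=> y _; rewrite lee_fin /q indicE.
  have [/set_mem/= xy|_] := boolP (y \in _); last first.
    by rewrite mul0r !mulr_ge0 ?normal_pdf_ge0 ?expR_ge0.
  rewrite mul1r (normal_pdf_widen _ _ s0); apply: ler_wpM2r.
    exact: normal_pdf_ge0.
  apply: ler_wpM2l => //; rewrite ler_expR lerN2 subr0.
  apply: ler_pM; rewrite ?sqr_ge0 ?invr_ge0 ?mulr_ge0 ?(ltW u0)//.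
    by rewrite -[leRHS]real_normK ?num_real// ler_sqr ?nnegrE// ltW.
  have s20 : 0 < s ^+ 2 by rewrite exprn_even_gt0.
  have su4 : 4 * s ^+ 2 <= 4 * u by rewrite ler_pM2l.
  have p1 : 0 < 4 * s ^+ 2 by exact: mulr_gt0.
  have p2 : 0 < 4 * u by exact: mulr_gt0.
  by rewrite lef_pV2 ?posrE.
rewrite /q; under eq_integral do rewrite EFinM.
rewrite integralZl//; last exact: integrable_normal_pdf.
by rewrite integral_normal_pdf mule1.
Qed.

End gaussian_laws.

(** * Positive definiteness of the covariance *)

Section finite_sums.
Variable R : realType.

(* A discrete form of [x = \int 1_{s <= x} ds]: it turns a minimum into a sum of
   products of indicators. *)
Lemma min_threshold_sum (D : finType) (x : D -> R) : (forall p, 0 < x p) ->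
  exists2 e : D -> R, (forall r, 0 < e r) &
    forall p, x p = \sum_(r | x r <= x p) e r.
Proof.
(* [pd y] is the largest value below [y], or 0 if there is none. The weight of [r] is the gap
   [x r - pd (x r)] shared among the [c r] indices with the same value, so that the gaps up to [x p]
   telescope. *)
move=> x0; pose pd (y : R) := \big[Num.max/0]_(q | x q < y) x q.
pose c (r : D) := #|[pred q | x q == x r]|.
have c0 r : 0 < (c r)%:R :> R by rewrite ltr0n; apply/card_gt0P; exists r; rewrite inE.
have pd_lt y : 0 < y -> pd y < y by move=> y0; apply/bigmax_ltP; split.
exists (fun r => (x r - pd (x r)) / (c r)%:R).
  by move=> r; rewrite divr_gt0// subr_gt0 pd_lt.
move=> p; have [n] := ubnP #|[pred r | x r < x p]|; elim: n p => // n IH p ltn.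
rewrite (bigID (fun r => x r == x p))/=.
rewrite [X in _ = X + _](_ : _ = x p - pd (x p)); last first.
  rewrite (eq_bigl (fun r => x r == x p)); last first.
    by move=> r; case: eqP => [->|]; rewrite ?lexx ?andbF.
  rewrite (eq_bigr (fun=> (x p - pd (x p)) / (c p)%:R)); last first.
    move=> r /eqP xr; rewrite xr /c; congr (_ / _%:R).
    by apply: eq_card => q; rewrite !inE xr.
  by rewrite sumr_const -[LHS]mulr_natr divfK// gt_eqF// c0.
rewrite [X in _ = _ + X](_ : _ = pd (x p)) ?subrK//.
rewrite (eq_bigl (fun r => x r < x p)); last first.
  by move=> r; rewrite lt_neqAle andbC.
have [[r0 r0p]|none] := pselect (exists r, x r < x p); last first.
  by rewrite /pd !big_pred0// => r; apply/negP => rp; apply: none; exists r.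
have [q qp mq] : exists2 q, x q < x p & forall r, x r < x p -> x r <= x q.
  have [q qp mq] := @arg_maxP _ _ _ r0 (fun r => x r < x p) x r0p.
  by exists q => // r; exact: mq.
have pdq : pd (x p) = x q.
  apply/le_anti/andP; split; last by apply: le_bigmax_cond.
  by apply/bigmax_leP; split; [exact: ltW|].
rewrite pdq (eq_bigl (fun r => x r <= x q)); last first.
  move=> r; apply/idP/idP; first exact: mq.
  by move=> h; exact: le_lt_trans h qp.
apply/esym/IH; rewrite -ltnS; apply: leq_trans ltn; rewrite ltnS; apply: proper_card.
apply/properP; split; last by exists q; rewrite !inE// ltxx.
by apply/fintype.subsetP => r; rewrite !inE => h; exact: lt_trans h qp.
Qed.


Lemma prodr_natb (D : finType) (b : D -> bool) :
  \prod_l (b l)%:R = [forall l, b l]%:R :> R.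
Proof.
case: (boolP [forall l, b l]) => [/forallP h|/forallPn[l /negbTE h]].
  by rewrite big1// => l _; rewrite h.
by rewrite (bigD1 l)//= h mul0r.
Qed.

(** The variance of [\sum_p a p * B^i(t p)] for a single component [i] of the sheet. *)
Definition min_form (k N : nat) (t : 'I_k -> 'rV[R]_N) (a : 'I_k -> R) : R :=
  \sum_p \sum_q a p * a q * \prod_l Num.min (t p 0 l) (t q 0 l).

(** Each minimum is a sum over thresholds. Expanding the product over the axes gives one term per
    choice [f] of a threshold point on each axis, that is per corner with coordinates [t (f l) 0 l].
    The indicator that the corner lies below both points is a product, so the double sum over [p]
    and [q] is a square. *)
Lemma min_form_gram (k N : nat) (t : 'I_k -> 'rV[R]_N) :
  (forall p l, 0 < t p 0 l) ->
  exists2 w : {ffun 'I_N -> 'I_k} -> R, (forall f, 0 < w f) &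
  forall a, min_form t a = \sum_f w f *
    (\sum_p a p * [forall l, (t (f l) 0 l <= t p 0 l)%R]%:R) ^+ 2.
Proof.
move=> t0.
have /choice[e eP] (l : 'I_N) : exists e : 'I_k -> R, (forall r, 0 < e r) /\
    forall p, t p 0 l = \sum_(r | t r 0 l <= t p 0 l) e r.
  by have [e e0 eE] := min_threshold_sum (fun p => t0 p l); exists e.
exists (fun f => \prod_l e l (f l)).
  by move=> f; apply: prodr_gt0 => l _; have [] := eP l.
move=> a.
have minE p q : \prod_l Num.min (t p 0 l) (t q 0 l) =
    \sum_(f : {ffun 'I_N -> 'I_k}) (\prod_l e l (f l)) *
      ([forall l, (t (f l) 0 l <= t p 0 l)%R]%:R *
       [forall l, (t (f l) 0 l <= t q 0 l)%R]%:R).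
  have E l : Num.min (t p 0 l) (t q 0 l) = \sum_r e l r *
      ((t r 0 l <= t p 0 l)%R%:R * (t r 0 l <= t q 0 l)%R%:R).
    have [_ eE] := eP l.
    transitivity (\sum_(r | t r 0 l <= Num.min (t p 0 l) (t q 0 l)) e l r).
      by case: leP => _; exact: eE.
    rewrite big_mkcond/=; apply: eq_bigr => r _.
    by rewrite le_min -natrM mulnb; case: ifP; rewrite ?mulr1 ?mulr0.
  under eq_bigr do rewrite E.
  rewrite bigA_distr_bigA/=; apply: eq_bigr => f _.
  rewrite !big_split/= ; congr (_ * (_ * _)).
    exact: prodr_natb.
  exact: prodr_natb.
rewrite /min_form; under eq_bigr do under eq_bigr do rewrite minE big_distrr/=.
under eq_bigr do rewrite exchange_big/=.
rewrite exchange_big/=; apply: eq_bigr => f _.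
rewrite expr2 big_distrl/= big_distrr/=; apply: eq_bigr => p _.
by rewrite !mulr_sumr; apply: eq_bigr => q _; ring.
Qed.

Lemma norm_lincomb_le (D : finType) (c x : D -> R) (b : R) :
  (forall p, `|x p| <= b) -> `|\sum_p x p * c p| <= b * \sum_p `|c p|.
Proof.
move=> xb; rewrite mulr_sumr; apply: le_trans (ler_norm_sum _ _ _) _.
by apply: ler_sum => p _; rewrite normrM ler_wpM2r.
Qed.

(** The corners with constant [f], namely the points themselves, suffice: their indicators form the
    incidence matrix [C] of the coordinatewise order, which is invertible because the points are
    distinct. *)
Lemma min_form_definite (k N : nat) (t : 'I_k -> 'rV[R]_N) :
  (forall p l, 0 < t p 0 l) -> injective t ->
  exists2 c, 0 < c & forall a, c * \sum_p a p ^+ 2 <= min_form t a.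
Proof.
move=> t0 injt; have [w w0 wE] := min_form_gram t0.
pose le r p := [forall l, (t r 0 l <= t p 0 l)%R].
pose C : 'M[R]_k := \matrix_(p, r) (le r p)%:R.
(* Look at a nonzero coordinate whose point has maximal coordinate sum. *)
have Cfree : row_free C.
  apply: inj_row_free => v /rowP vC0; apply/rowP => p; rewrite mxE.
  apply/eqP/negP => /negP vp0.
  pose S p := \sum_l t p 0 l.
  have [q vq mq] := @arg_maxP _ _ _ p (fun p => v 0 p != 0) S vp0.
  move: (vC0 q); rewrite !mxE (bigD1 q)//= mxE.
  have -> : le q q by apply/forallP.
  rewrite mulr1 big1 ?addr0 => [/eqP|r rq]; first by rewrite (negbTE vq).
  rewrite mxE; case: (boolP (le q r)) => [/forallP qr|]; last by rewrite mulr0.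
  have [->|vr] := eqVneq (v 0 r) 0; first by rewrite mul0r.
  exfalso; move/eqP: rq; apply; apply: injt; apply/rowP => l.
  have := mq r vr; rewrite /= /S => Sle.
  have D0 : \sum_l (t r 0 l - t q 0 l) == 0.
    rewrite eq_le sumrB subr_le0 Sle/= subr_ge0.
    by apply: ler_sum => l' _; exact: qr.
  rewrite psumr_eq0 in D0; last by move=> l' _; rewrite subr_ge0 qr.
  by move/allP: D0 => /(_ l (mem_index_enum _)) /=; rewrite subr_eq0 => /eqP.
have Cunit : C \in unitmx by rewrite -row_free_unit.
(* Let Q be the value of the form and [y] the image of [a] under [C]. One term of the Gram sum gives
   [w y_r^2 <= Q], hence [y_r^2 <= Q W]; inverting [C] gives [a_p^2 <= Q W S^2]. Adding 1 below
   keeps the divisor positive. *)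
pose S := \sum_p \sum_r `|invmx C r p|.
pose W := \sum_r (w [ffun=> r])^-1.
have W0 : 0 <= W by apply: sumr_ge0 => r _; rewrite invr_ge0 ltW.
have S0 : 0 <= S by apply: sumr_ge0 => p _; apply: sumr_ge0.
have kWS0 : 0 <= k%:R * (W * S ^+ 2) by rewrite !mulr_ge0// sqr_ge0.
exists (1 + k%:R * (W * S ^+ 2))^-1; first by rewrite invr_gt0 ltr_wpDr.
move=> a; have Q0 : 0 <= min_form t a.
  by rewrite wE; apply: sumr_ge0 => f _; rewrite mulr_ge0 ?sqr_ge0// ltW.
pose v := \row_p a p; pose y := v *m C.
have yQ r : `|y 0 r| <= Num.sqrt (min_form t a * W).
  rewrite -sqrtr_sqr ler_sqrt ?mulr_ge0//.
  have : w [ffun=> r] * y 0 r ^+ 2 <= min_form t a.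
    rewrite wE (bigD1 [ffun=> r])//= -[leLHS]addr0 lerD//.
      rewrite le_eqVlt; apply/orP; left; apply/eqP; congr (_ * _ ^+ 2).
      rewrite /y mxE; apply: eq_bigr => p _; rewrite !mxE; congr (_ * _%:R).
      by congr nat_of_bool; apply: eq_forallb => l; rewrite ffunE.
    by apply: sumr_ge0 => f _; rewrite mulr_ge0 ?sqr_ge0// ltW.
  rewrite mulrC -ler_pdivlMr// => /le_trans; apply; apply: ler_wpM2l => //.
  by rewrite /W (bigD1 r)//= lerDl sumr_ge0// => r' _; rewrite invr_ge0 ltW.
have aE p : a p = \sum_r y 0 r * invmx C r p.
  have : (y *m invmx C) 0 p = a p by rewrite /y mulmxK// mxE.
  by rewrite mxE => ->.
have ap p : a p ^+ 2 <= min_form t a * (W * S ^+ 2).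
  rewrite mulrA -[X in _ <= X * _]sqr_sqrtr ?mulr_ge0// -exprMn.
  rewrite -[leLHS]real_normK ?num_real// ler_sqr ?nnegrE ?mulr_ge0 ?sqrtr_ge0//.
  rewrite aE; apply: le_trans (norm_lincomb_le _ yQ) _.
  apply: ler_wpM2l; first exact: sqrtr_ge0.
  by rewrite /S [leRHS](bigD1 p)//= lerDl sumr_ge0// => p' _; exact: sumr_ge0.
rewrite mulrC ler_pdivrMr; last by rewrite ltr_wpDr.
apply: (@le_trans _ _ (\sum_(p < k) min_form t a * (W * S ^+ 2))).
  by apply: ler_sum => p _; exact: ap.
rewrite sumr_const card_ord -[leLHS]mulr_natr -[leLHS]mulrA.
by apply: ler_wpM2l => //; rewrite [leLHS]mulrC lerDr.
Qed.

(** If points [p] and [q] coincide, the form vanishes at [e_p - e_q]; if point [p] has a zero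
    coordinate, it vanishes at [e_p]. With [min_form_definite], ellipticity thus encodes
    distinctness and positivity exactly. *)
Lemma min_form_definite_inj (k N : nat) (t : 'I_k -> 'rV[R]_N) (c : R) :
  0 < c -> (forall p l, 0 <= t p 0 l) ->
  (forall a, c * \sum_p a p ^+ 2 <= min_form t a) ->
  injective t /\ forall p l, 0 < t p 0 l.
Proof.
move=> c0 t0 tc; split.
  move=> p q tpq; apply/eqP/negP => /negP pq.
  have := tc (fun r => (r == p)%:R - (r == q)%:R).
  have -> : min_form t (fun r => (r == p)%:R - (r == q)%:R) = 0.
    rewrite /min_form.
    have E (F : 'I_k -> R) : F p = F q ->
        \sum_r ((r == p)%:R - (r == q)%:R) * F r = 0.
      move=> Fpq; under eq_bigr do rewrite mulrBl.
      rewrite sumrB (bigD1 p)//= [X in _ - X](bigD1 q)//=.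
      rewrite !big1 ?addr0 ?eqxx ?mul1r ?Fpq ?subrr// => r /negbTE ->;
        by rewrite mul0r.
    rewrite big1// => r _.
    rewrite -[RHS](mulr0 ((r == p)%:R - (r == q)%:R)).
    rewrite -[in RHS](E (fun s => \prod_l Num.min (t r 0 l) (t s 0 l))); last first.
      by rewrite tpq.
    by rewrite mulr_sumr; apply: eq_bigr => s _; rewrite mulrA.
  rewrite leNgt => /negP; apply; apply: mulr_gt0 => //.
  rewrite (bigD1 p)//= eqxx (negbTE pq) subr0 expr1n ltr_wpDr//.
  by apply: sumr_ge0 => r _; exact: sqr_ge0.
move=> p l; rewrite lt_neqAle t0 andbT; apply/eqP => tpl.
have := tc (fun r => (r == p)%:R).
have -> : min_form t (fun r => (r == p)%:R) = 0.
  rewrite /min_form big1// => r _; rewrite big1// => s _.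
  have [->|] := eqVneq r p; last by rewrite !mul0r.
  have [->|] := eqVneq s p; last by rewrite mulr0 mul0r.
  by rewrite (bigD1 l)//= minxx -tpl !mul0r mulr0.
rewrite leNgt => /negP; apply; apply: mulr_gt0 => //.
rewrite (bigD1 p)//= eqxx expr1n ltr_wpDr//.
by apply: sumr_ge0 => r _; exact: sqr_ge0.
Qed.

Lemma dist_min_le (x y x' y' e : R) : `|x - x'| <= e -> `|y - y'| <= e ->
  `|Num.min x y - Num.min x' y'| <= e.
Proof.
rewrite !ler_norml => /andP[? ?] /andP[? ?].
by have [?|?] := leP x y; have [?|?] := leP x' y'; apply/andP; split; lra.
Qed.

Lemma dist_prod_le (N : nat) (x y : 'I_N -> R) (L e : R) : 1 <= L ->
  (forall l, `|x l| <= L) -> (forall l, `|y l| <= L) ->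
  (forall l, `|x l - y l| <= e) ->
  `|\prod_l x l - \prod_l y l| <= N%:R * L ^+ N * e.
Proof.
move=> L1; have L0 : 0 <= L by lra.
elim: N x y => [|N IH] x y xL yL xy.
  by rewrite !big_ord0 subrr normr0 !mul0r.
have e0 : 0 <= e by apply: le_trans (xy ord0).
rewrite !big_ord_recl.
set X := \prod_(i < N) _; set Y := \prod_(i < N) _.
have -> : x ord0 * X - y ord0 * Y = x ord0 * (X - Y) + (x ord0 - y ord0) * Y by ring.
apply: le_trans (ler_normD _ _) _; rewrite !normrM.
have h1 : `|X - Y| <= N%:R * L ^+ N * e by apply: IH => l.
have h2 : `|Y| <= L ^+ N.
  rewrite normr_prod -[X in _ <= L ^+ X]card_ord -prodr_const.
  by apply: ler_prod => l _; rewrite normr_ge0 yL.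
have L1N : L ^+ N <= L ^+ N.+1 by rewrite exprS ler_peMl// exprn_ge0.
rewrite -natr1 !mulrDl mul1r; apply: lerD.
  apply: le_trans (ler_pM _ _ (xL _) h1) _ => //.
  by rewrite le_eqVlt exprS; apply/orP; left; apply/eqP; ring.
rewrite mulrC; apply: ler_pM => //; exact: le_trans L1N.
Qed.

(** Carries ellipticity over to nearby tuples: from a tuple to its grid cell, and from a sequence to
    a limit point. *)
Lemma min_form_lipschitz (k N : nat) (s t : 'I_k -> 'rV[R]_N) (L e : R) :
  1 <= L -> (forall p l, 0 <= s p 0 l <= L) -> (forall p l, 0 <= t p 0 l <= L) ->
  (forall p l, `|s p 0 l - t p 0 l| <= e) ->
  forall a, `|min_form s a - min_form t a| <=
    k%:R * (N%:R * L ^+ N * e) * \sum_p a p ^+ 2.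
Proof.
move=> L1 sL tL st a; rewrite /min_form -sumrB.
set D := N%:R * L ^+ N * e.
have minL (u : 'I_k -> 'rV[R]_N) : (forall p l, 0 <= u p 0 l <= L) ->
    forall p q l, `|Num.min (u p 0 l) (u q 0 l)| <= L.
  move=> uL p q l; have /andP[p0 pL] := uL p l; have /andP[q0 qL] := uL q l.
  by rewrite ger0_norm ?ge_min ?le_min ?p0 ?pL.
have D1 p q : `|\prod_l Num.min (s p 0 l) (s q 0 l) -
    \prod_l Num.min (t p 0 l) (t q 0 l)| <= D.
  apply: dist_prod_le => // l; try exact: minL.
  by apply: dist_min_le; exact: st.
have DE : k%:R * D * \sum_p a p ^+ 2 =
    \sum_(p < k) \sum_(q < k) D * ((a p ^+ 2 + a q ^+ 2) / 2).
  under [RHS]eq_bigr do rewrite -mulr_sumr -mulr_suml big_split/=.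
  rewrite -mulr_sumr -mulr_suml big_split/= sumr_const card_ord.
  under [X in _ = D * ((X + _) / 2)]eq_bigr do rewrite sumr_const card_ord.
  have half (x : R) : (x + x) / 2 = x by field.
  rewrite sumrMnl; set S := \sum_(p < k) a p ^+ 2.
  by rewrite half -(mulr_natl S) (mulrA D) (mulrC D).
rewrite DE; apply: le_trans (ler_norm_sum _ _ _) _; apply: ler_sum => p _.
rewrite -sumrB; apply: le_trans (ler_norm_sum _ _ _) _; apply: ler_sum => q _.
rewrite -mulrBr normrM mulrC; apply: ler_pM => //.
rewrite ler_norml; apply/andP; split.
  by have := sqr_ge0 (a p + a q); rewrite sqrrD; lra.
by have := sqr_ge0 (a p - a q); rewrite sqrrB; lra.
Qed.


End finite_sums.

(** * Small ball estimate *)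

Section small_ball.
Variable R : realType.

Lemma sum_geometric_le (q : R) (n : nat) : 0 <= q < 1 ->
  \sum_(b < n) q ^+ b <= (1 - q)^-1.
Proof.
move=> /andP[q0 q1].
rewrite -[leRHS]mul1r ler_pdivlMr ?subr_gt0// mulrC -[1 - q]opprB mulNr -subrX1.
by rewrite opprB lerBlDr lerDl exprn_ge0.
Qed.

(** With truncated subtraction, [(a - b) + (b - a)] is the distance of [a] and [b]. Each side of the
    diagonal contributes at most one geometric series. *)
Lemma sum_geometric_dist_le (q : R) (M a : nat) : 0 <= q < 1 ->
  \sum_(b < M) q ^+ ((a - b) + (b - a)) <= 2 / (1 - q).
Proof.
move=> q01; have /andP[q0 q1] := q01.
rewrite mulrDl mul1r (bigID (fun b : 'I_M => (b <= a)%N))/=; apply: lerD.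
  apply: le_trans (_ : \sum_(b < a.+1) q ^+ b <= _); last exact: sum_geometric_le.
  rewrite [leRHS](reindex_inj rev_ord_inj)/=.
  rewrite (big_ord_widen_cond (M + a.+1) (fun b => b <= a)%N
    (fun b => q ^+ ((a - b) + (b - a)))) ?leq_addr//.
  rewrite (big_ord_widen (M + a.+1) (fun b => q ^+ (a.+1 - b.+1))) ?leq_addl//.
  rewrite big_mkcond [leRHS]big_mkcond/=; apply: ler_sum => b _.
  rewrite ltnS; case: (leqP b a) => //= ba.
  case: ifP => _; last exact: exprn_ge0.
  by rewrite subSS (eqP (ba : (b - a == 0)%N)) addn0.
have [Ma|aM] := leqP M a.
  rewrite big1 ?invr_ge0 ?subr_ge0 ?ltW// => b.
  by rewrite -ltnNge => ab; have := ltn_ord b; lia.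
have -> : M = (a + (M - a))%N by rewrite subnKC// ltnW.
rewrite big_mkcond big_split_ord/= big1 ?add0r; last first.
  by move=> b _; case: ifP => //; have := ltn_ord b; lia.
apply: le_trans (sum_geometric_le (M - a) q01); apply: ler_sum => b _.
case: ifP => _; last exact: exprn_ge0.
by rewrite le_eqVlt; apply/orP; left; apply/eqP; congr (_ ^+ _); lia.
Qed.

Lemma cos_ge_cos1 (x : R) : `|x| <= 1 -> cos 1 <= cos x.
Proof.
move=> x1; rewrite -(cos_norm x) leNgt ltr_cos ?in_itv/= ?normr_ge0 -?leNgt//.
- by rewrite ler01 (le_trans _ (pi_ge2 R))// ler1n.
- by rewrite (le_trans x1)// (le_trans _ (pi_ge2 R))// ler1n.
Qed.

(* The sum of [cos ((m - m') . eta X)] over frequencies [m, m'] in [[0, M)^D] is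
   nonnegative, of order [M ^ (2 #|D|)] on the event, and its mean is of order
   [M ^ #|D|]. *)
Lemma small_ball (D : finType) (lam C : R) : 0 < lam -> 0 < C ->
  exists2 K, 0 <= K & forall d (T : measurableType d) (P : probability T R)
    (X : D -> T -> R), (forall x, measurable_fun setT (X x)) ->
    (forall c : D -> R, (\int[P]_w (cos (\sum_x c x * X x w)%R)%:E <=
       (expR (- (lam * (\sum_x c x ^+ 2)%R / 2)))%:E)%E) ->
    forall M : nat, (0 < M)%N ->
    (P [set w | forall x, (`|X x w| <= C / M%:R)%R] <= (K / M%:R ^+ #|D|)%:E)%E.
Proof.
move=> lam0 C0.
(* On the event each term of a phase is at most [eta * M * (C / M)], the inverse of [#|D|.+1], so
   every phase is at most 1 and its cosine at least [cos 1 > 0]. The successor covers an empty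
   [D]. *)
pose eta := (C * #|D|.+1%:R)^-1.
have eta0 : 0 < eta by rewrite invr_gt0 mulr_gt0.
pose q := expR (- (lam * eta ^+ 2 / 2)).
have q01 : 0 <= q < 1.
  rewrite /q expR_ge0 expR_lt1 oppr_lt0 divr_gt0// mulr_gt0// exprn_gt0//.
have c1 : 0 < cos 1 :> R by exact: cos1_gt0.
exists ((2 / (1 - q)) ^+ #|D| / cos 1).
  rewrite divr_ge0 ?(ltW c1)// exprn_ge0// divr_ge0// subr_ge0 ltW//.
  by case/andP: q01.
move=> d T P X mX Xcos M M0.
set A := [set w | _].
have mA : measurable A.
  by apply: measurable_forall_fin => x; exact: measurable_norm_le.
pose FF := {ffun D -> 'I_M}.
pose theta (m : FF) w := \sum_x eta * (m x)%:R * X x w.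
have thetaB (m m' : FF) w : theta m w - theta m' w =
    \sum_x (eta * ((m x)%:R - (m' x)%:R)) * X x w.
  by rewrite /theta -sumrB; apply: eq_bigr => x _; ring.
have mtheta m : measurable_fun setT (theta m).
  by apply: measurable_sum => x; exact: measurable_funM.
pose F w := \sum_(p : FF * FF) cos (theta p.1 w - theta p.2 w).
have F0 w : 0 <= F w.
  (* [F] is the squared modulus of the exponential sum with phases [theta m w]. *)
  have -> : F w = (\sum_m cos (theta m w)) ^+ 2 + (\sum_m sin (theta m w)) ^+ 2.
    rewrite /F -(pair_bigA _ (fun m m' : FF => cos (theta m w - theta m' w)))/=.
    under eq_bigr do under eq_bigr do rewrite cosB.
    under eq_bigr do rewrite big_split/= -!mulr_sumr.
    by rewrite big_split/= -!mulr_suml !expr2.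
  by rewrite addr_ge0// sqr_ge0.
have mcos p : measurable_fun setT (fun w => cos (theta p.1 w - theta p.2 w)).
  apply: measurableT_comp; last exact: measurable_funB.
  by apply: continuous_measurable_fun; exact: continuous_cos.
have mF : measurable_fun setT F by exact: measurable_sum.
have intcos p : P.-integrable setT (fun w => (cos (theta p.1 w - theta p.2 w))%:E).
  apply: measurable_bounded_integrable => //; first by rewrite (le_lt_trans (probability_le1 _ _))// ltry.
  by exists 1; split => // y y1 w _ /=; exact: le_trans (cos_max _) (ltW y1).
have FA w : A w -> cos 1 * (M%:R ^+ #|D|) ^+ 2 <= F w.
  move=> Aw.
  have -> : cos 1 * (M%:R ^+ #|D|) ^+ 2 = \sum_(p : FF * FF) cos 1 :> R.
    rewrite sumr_const card_prod card_ffun card_ord -[RHS]mulr_natr.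
    by rewrite natrM natrX expr2.
  apply: ler_sum => p _; apply: cos_ge_cos1; rewrite thetaB.
  apply: le_trans (ler_norm_sum _ _ _) _.
  apply: (@le_trans _ _ (\sum_(x : D) (#|D|.+1%:R)^-1)).
    apply: ler_sum => x _; rewrite !normrM (gtr0_norm eta0).
    have M0' : (0 : R) < M%:R by rewrite ltr0n.
    have h1 : `|(p.1 x)%:R - (p.2 x)%:R| <= M%:R :> R.
      have := ltn_ord (p.1 x); have := ltn_ord (p.2 x).
      rewrite -!(ltr_nat R) ler_norml => ? ?.
      have := ler0n R (p.1 x); have := ler0n R (p.2 x) => ? ?.
      by apply/andP; split; lra.
    apply: le_trans (ler_pM _ _ (ler_wpM2l (ltW eta0) h1) (Aw x)) _ => //.
      by rewrite mulr_ge0// ltW.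
    rewrite /eta le_eqVlt; apply/orP; left; apply/eqP; field.
    by rewrite !gt_eqF//= addrC natr1.
  by rewrite sumr_const -[leLHS]mulr_natr ler_pdivrMl// mulr1 ler_nat.
have intF : (\int[P]_w (F w)%:E <= (((M%:R : R) * (2 / (1 - q))) ^+ #|D|)%:E)%E.
  rewrite /F; under eq_integral do rewrite -sumEFin.
  rewrite integral_sum//.
  pose G (a b : 'I_M) := q ^+ ((a - b) + (b - a)).
  apply: (@le_trans _ _ (\sum_(p : FF * FF) (\prod_x G (p.1 x) (p.2 x))%:E)%E).
    apply: lee_sum => p _; under eq_integral do rewrite thetaB.
    apply: le_trans (Xcos _) _; rewrite lee_fin mulrAC mulr_sumr -sumrN expR_sum.
    apply: ler_prod => x _; rewrite expR_ge0/= /G /q -expRM_natl ler_expR.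
    rewrite mulrN lerN2 exprMn mulrA [X in _ <= X * _]mulrAC [X in X <= _]mulrC.
    apply: ler_wpM2l; first by rewrite divr_ge0// mulr_ge0 ?ltW// exprn_gt0.
    (* [n <= n^2] weakens the Gaussian decay in the frequency difference to a geometric one. *)
    have sq (n : nat) : n%:R <= n%:R ^+ 2 :> R by rewrite -natrX ler_nat; nia.
    have [ab|/ltnW ab] := leqP (p.1 x) (p.2 x).
      by rewrite (eqP (ab : (_ - _ == 0)%N)) add0n -sqrrN opprB -natrB.
    by rewrite (eqP (ab : (_ - _ == 0)%N)) addn0 -natrB.
  rewrite sumEFin lee_fin -(pair_bigA _ (fun m m' : FF => \prod_x G (m x) (m' x)))/=.
  (* The sum over pairs of frequency vectors factors over [D]; each factor costs [M] instead of
     [M^2]. *)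
  under eq_bigr do rewrite -(bigA_distr_bigA (fun x b => G (_ x) b))/=.
  rewrite -(bigA_distr_bigA (fun x a => \sum_b G a b))/= -prodr_const.
  apply: ler_prod => x _; rewrite sumr_ge0/= => [|a _]; last first.
    by apply: sumr_ge0 => b _; rewrite exprn_ge0//; case/andP: q01.
  apply: (@le_trans _ _ (\sum_(a < M) 2 / (1 - q))).
    by apply: ler_sum => a _; exact: sum_geometric_dist_le.
  by rewrite sumr_const card_ord -[leLHS]mulr_natl.
have : ((cos 1 * (M%:R ^+ #|D|) ^+ 2)%:E * P A <= (((M%:R : R) * (2 / (1 - q))) ^+ #|D|)%:E)%E.
  apply: le_trans intF; rewrite -[A in P A]setIT -integral_indic// -ge0_integralZl//; last 2 first.
  - exact/measurable_EFinP/measurable_indic.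
  - by rewrite lee_fin mulr_ge0 ?(ltW c1)// sqr_ge0.
  apply: ge0_le_integral => //.
  - by move=> w _; rewrite -EFinM lee_fin !mulr_ge0 ?(ltW c1)// sqr_ge0.
  - by apply/measurable_EFinP/measurable_funM => //; exact: measurable_indic.
  - exact/measurable_EFinP.
  move=> w _; rewrite -EFinM lee_fin indicE.
  by have [/set_mem/FA|_] := boolP (w \in A); rewrite ?mulr1// mulr0.
rewrite -[P A]fineK ?fin_num_measure// -EFinM !lee_fin exprMn.
have Z0 : 0 < M%:R ^+ #|D| :> R by rewrite exprn_gt0// ltr0n.
move: (fine _) (M%:R ^+ #|D|) Z0 => p Z Z0 h.
rewrite !ler_pdivlMr// -(ler_pM2l Z0); apply: le_trans h.
by rewrite le_eqVlt; apply/orP; left; apply/eqP; ring.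
Qed.

End small_ball.

(** * Linear combinations of sheet coordinates *)

Section sheet_laws.
Context (disp : measure_display) (T : measurableType disp) (R : realType).
Variable P : probability T R.

Lemma integral_linear_comb (I : finType) (Z : I -> T -> R) (c : I -> R) :
  (forall x, P.-integrable setT (fun w => (Z x w)%:E)) ->
  (\int[P]_w (\sum_x c x * Z x w)%:E =
   \sum_x (c x)%:E * \int[P]_w (Z x w)%:E)%E.
Proof.
move=> intZ; under eq_integral do rewrite -sumEFin.
have int x : P.-integrable setT (fun w => (c x * Z x w)%:E).
  by under eq_fun do rewrite EFinM; exact: integrableZl.
rewrite integral_sum//; apply: eq_bigr => x _.
by under eq_integral do rewrite EFinM; rewrite integralZl.
Qed.

Variables (N d : nat) (B : 'rV[R]_N -> T -> 'rV[R]_d).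
Hypothesis B_sheet : brownian_sheet P B.

Lemma sheet_coord_gaussian (t : 'rV[R]_N) (i : 'I_d) : orthant R N t ->
  gaussian_rv P (fun w => B t w 0 i).
Proof.
move=> t0; have := sheet_gaussian B_sheet (fun _ : 'I_1 => delta_mx 0 i) (fun=> t0).
congr (gaussian_rv P _); apply/funext => w.
rewrite big_ord1 (bigD1 i)//= mxE !eqxx mul1r big1 ?addr0// => j ji.
by rewrite mxE (negbTE ji) andbF mul0r.
Qed.

Lemma sheet_coord_integral (t : 'rV[R]_N) (i : 'I_d) : orthant R N t ->
  P.-integrable setT (fun w => (B t w 0 i)%:E) /\
  (\int[P]_w (B t w 0 i)%:E = 0)%E.
Proof.
move=> t0; split; first exact: gaussian_rv_integrable (sheet_coord_gaussian i t0).
by have := sheet_centered B_sheet i t0; rewrite unlock.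
Qed.

Lemma sheet_coord_cov (s t : 'rV[R]_N) (i j : 'I_d) : orthant R N s -> orthant R N t ->
  P.-integrable setT (fun w => (B s w 0 i * B t w 0 j)%:E) /\
  (\int[P]_w (B s w 0 i * B t w 0 j)%:E =
    ((i == j)%:R * \prod_l Num.min (s 0 l) (t 0 l))%:E)%E.
Proof.
move=> s0 t0.
have gs := sheet_coord_gaussian i s0; have gt := sheet_coord_gaussian j t0.
have [? _ [is2 _ _ _]] := gaussian_rv_laws gs (sheet_coord_integral i s0).2.
have [? _ [it2 _ _ _]] := gaussian_rv_laws gt (sheet_coord_integral j t0).2.
have [ms _] := gs; have [mt _] := gt.
split.
  apply: (@le_integrable _ _ _ P setT _ _
    (fun w => (B s w 0 i ^+ 2 + B t w 0 j ^+ 2)%:E)) => //.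
  - by apply/measurable_EFinP; exact: measurable_funM.
  - move=> w _ /=; rewrite lee_fin normrM.
    rewrite [leRHS]ger0_norm ?addr_ge0 ?sqr_ge0//.
    rewrite -[X in _ <= X + _]real_normK ?num_real//.
    rewrite -[X in _ <= _ + X]real_normK ?num_real//.
    have key (a b : R) : a * b <= a ^+ 2 + b ^+ 2 by nra.
    exact: key.
  - by under eq_fun do rewrite EFinD; exact: integrableD.
have := sheet_covariance B_sheet i j s0 t0.
rewrite unlock !(sheet_centered B_sheet)// unlock /= => <-.
apply: eq_integral => w _; congr EFin.
by rewrite -[RHS]/((B s w 0 i - 0) * (B t w 0 j - 0)) !subr0.
Qed.

(** The law of [Y] is normal with unknown variance, which is identified by expanding the second
    moment. Distinct components are uncorrelated, so one form per component remains. *)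
Lemma sheet_comb_laws (n : nat) (t : 'I_n -> 'rV[R]_N) (a : 'I_n -> 'rV[R]_d) :
  (forall p, orthant R N (t p)) ->
  let Y w := \sum_(p < n) \sum_(i < d) a p 0 i * B (t p) w 0 i in
  let v := \sum_i min_form t (fun p => a p 0 i) in
  (\int[P]_w (cos (Y w))%:E = (expR (- (v / 2)))%:E)%E /\
  forall u x : R, v <= u -> 0 < u -> 0 < x -> (P [set w | (x <= `|Y w|)%R] <=
      (Num.sqrt 2 * expR (- (x ^+ 2 / (4 * u))))%:E)%E.
Proof.
move=> t0 Y v.
pose Z (x : 'I_n * 'I_d) w := B (t x.1) w 0 x.2.
pose c (x : 'I_n * 'I_d) := a x.1 0 x.2.
have YE w : Y w = \sum_x c x * Z x w.
  by rewrite /Y (pair_bigA _ (fun p i => a p 0 i * B (t p) w 0 i)).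
have Y0 : (\int[P]_w (Y w)%:E = 0)%E.
  under eq_integral do rewrite YE.
  rewrite integral_linear_comb => [|x].
    by rewrite big1// => x _; rewrite (sheet_coord_integral x.2 (t0 x.1)).2 mule0.
  exact: (sheet_coord_integral x.2 (t0 x.1)).1.
have [u u0 [_ Y2 Ycos Ytail]] := gaussian_rv_laws (sheet_gaussian B_sheet a t0) Y0.
suff uv : u = v by rewrite -uv.
apply: EFin_inj; rewrite -Y2.
pose ZZ (x : ('I_n * 'I_d) * ('I_n * 'I_d)) w := Z x.1 w * Z x.2 w.
have Y2E w : Y w ^+ 2 = \sum_x (c x.1 * c x.2) * ZZ x w.
  rewrite YE expr2 big_distrl/=; under eq_bigr do rewrite big_distrr/=.
  by rewrite pair_bigA/=; apply: eq_bigr => x _; rewrite /ZZ; ring.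
rewrite -/(Y _); under eq_integral do rewrite -/(Y _) Y2E.
have cov x := sheet_coord_cov x.1.2 x.2.2 (t0 x.1.1) (t0 x.2.1).
rewrite integral_linear_comb => [|x]; last exact: (cov x).1.
under eq_bigr do rewrite (cov _).2 -EFinM.
rewrite sumEFin; congr EFin.
rewrite -(pair_bigA _ (fun x y : 'I_n * 'I_d => c x * c y *
  ((x.2 == y.2)%:R * \prod_l Num.min (t x.1 0 l) (t y.1 0 l))))/=.
rewrite -(pair_bigA _ (fun p i => \sum_(y : 'I_n * 'I_d) c (p, i) * c y *
  ((i == y.2)%:R * \prod_l Num.min (t p 0 l) (t y.1 0 l))))/=.
rewrite exchange_big/=; apply: eq_bigr => i _; apply: eq_bigr => p _.
rewrite -(pair_bigA _ (fun q j => c (p, i) * c (q, j) *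
  ((i == j)%:R * \prod_l Num.min (t p 0 l) (t q 0 l))))/=.
apply: eq_bigr => q _; rewrite (bigD1 i)//= eqxx mul1r [X in _ + X]big1 ?addr0// => j ji.
by rewrite eq_sym (negbTE ji) mul0r mulr0.
Qed.

(** For comparable points the minima are the coordinates of [s], and the variance of the increment
    is the difference of the volumes of two boxes. This is why grid points are rounded down. *)
Lemma sheet_increment_tail (s t : 'rV[R]_N) (i : 'I_d) :
  orthant R N s -> (forall l, s 0 l <= t 0 l) ->
  forall u x : R, \prod_l t 0 l - \prod_l s 0 l <= u -> 0 < u -> 0 < x ->
  (P [set w | (x <= `|B t w 0 i - B s w 0 i|)%R] <=
    (Num.sqrt 2 * expR (- (x ^+ 2 / (4 * u))))%:E)%E.
Proof.
move=> s0 st v x.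
have t0 : orthant R N t by move=> l; exact: le_trans (s0 l) (st l).
pose u (p : 'I_2) := if p == 0 then s else t.
pose a (p : 'I_2) : 'rV[R]_d := (if p == 0 then -1 else 1) *: delta_mx 0 i.
have u0 p : orthant R N (u p) by rewrite /u; case: ifP.
have [_ /(_ v x)] := sheet_comb_laws a u0.
have aE p j : a p 0 j = (if p == 0 then -1 else 1) * (j == i)%:R.
  by rewrite !mxE eqxx.
have minst : \prod_l Num.min (s 0 l) (t 0 l) = \prod_l s 0 l.
  by apply: eq_bigr => l _; apply/min_idPl.
have mints : \prod_l Num.min (t 0 l) (s 0 l) = \prod_l s 0 l.
  by apply: eq_bigr => l _; apply/min_idPr.
have -> : \sum_j min_form u (fun p => a p 0 j) = \prod_l t 0 l - \prod_l s 0 l.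
  rewrite (bigD1 i)//= big1 => [|j /negbTE ji]; last first.
    by rewrite /min_form big1// => p _; rewrite big1// => q _; rewrite !aE ji !mulr0 !mul0r.
  rewrite /min_form !big_ord_recl !big_ord0 !aE /u/= eqxx minst mints.
  rewrite -[X in _ + (_ + (_ * X + _) + _) + _]/(\prod_l Num.min (t 0 l) (t 0 l)).
  under [\prod_l Num.min (t 0 l) (t 0 l)]eq_bigr do rewrite minxx.
  under [\prod_l Num.min (s 0 l) (s 0 l)]eq_bigr do rewrite minxx.
  by rewrite (_ : true%:R = 1)//; ring.
have sel (c : R) (f : 'I_d -> R) : \sum_j c * (j == i)%:R * f j = c * f i.
  rewrite (bigD1 i)//= eqxx mulr1 big1 ?addr0// => j /negbTE ->.
  by rewrite mulr0 mul0r.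
have YE w : \sum_p \sum_j a p 0 j * B (u p) w 0 j = B t w 0 i - B s w 0 i.
  under eq_bigr do under eq_bigr do rewrite aE.
  under eq_bigr do rewrite sel.
  by rewrite !big_ord_recl big_ord0 /u/=; ring.
rewrite (_ : [set w | _] = [set w | (x <= `|B t w 0 i - B s w 0 i|)%R])//.
by apply/seteqP; split => w /=; rewrite YE.
Qed.

(** The hypothesis of [small_ball] for the differences to the point [ord0]: they form a combination
    in which [ord0] has minus the sum of the other coefficients, and dropping its square only
    weakens the ellipticity bound. *)
Lemma sheet_cos_le (k : nat) (t : 'I_k.+1 -> 'rV[R]_N) (lam : R) : 0 <= lam ->
  (forall p, orthant R N (t p)) ->
  (forall a, lam * \sum_p a p ^+ 2 <= min_form t a) ->
  forall c : 'I_k * 'I_d -> R,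
  (\int[P]_w (cos (\sum_x c x * (B (t (lift ord0 x.1)) w 0 x.2 - B (t ord0) w 0 x.2))%R)%:E <=
    (expR (- (lam * (\sum_x c x ^+ 2)%R / 2)))%:E)%E.
Proof.
move=> lam0 t0 tlam c.
pose a (p : 'I_k.+1) : 'rV[R]_d := \row_i
  if unlift ord0 p is Some q then c (q, i) else - \sum_q c (q, i).
have pairE (F : 'I_k * 'I_d -> R) : \sum_x F x = \sum_q \sum_i F (q, i).
  by rewrite pair_bigA; apply: eq_bigr => -[].
have [+ _] := sheet_comb_laws a t0.
have a0 i : a ord0 0 i = - \sum_q c (q, i) by rewrite mxE unlift_none.
have aS q i : a (lift ord0 q) 0 i = c (q, i) by rewrite mxE liftK.
rewrite (_ : (fun w => _) = (fun w => (cos (\sum_x c x *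
   (B (t (lift ord0 x.1)) w 0 x.2 - B (t ord0) w 0 x.2))%R)%:E)) => [->|]; last first.
  apply/funext => w; congr (cos _)%:E; rewrite big_ord_recl.
  under eq_bigr do rewrite a0 mulNr mulr_suml.
  under [X in _ + X]eq_bigr do under eq_bigr do rewrite aS.
  rewrite sumrN exchange_big/= -sumrN -big_split/=.
  rewrite pairE; apply: eq_bigr => q _; rewrite -sumrN -big_split/=.
  by apply: eq_bigr => i _; ring.
rewrite lee_fin ler_expR lerN2 ler_pM2r ?invr_gt0//.
rewrite pairE exchange_big/= mulr_sumr.
apply: ler_sum => i _; apply: le_trans (tlam _); apply: ler_wpM2l => //.
rewrite big_ord_recl; under [X in _ <= _ + X]eq_bigr do rewrite aS.
by rewrite lerDr sqr_ge0.
Qed.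

End sheet_laws.

(** * Dyadic grids and chaining *)

Section grids.
Variable R : realType.

Definition grid_point (N m : nat) (g : 'I_N -> nat) : 'rV[R]_N :=
  \row_l ((g l)%:R / m%:R).

Definition grid_floor (N m : nat) (t : 'rV[R]_N) (l : 'I_N) : nat :=
  Num.truncn (t 0 l * m%:R).

Lemma orthant_grid_point N m (g : 'I_N -> nat) : orthant R N (grid_point m g).
Proof. by move=> l; rewrite mxE divr_ge0. Qed.

Lemma grid_floor_itv N m (t : 'rV[R]_N) (l : 'I_N) : (0 < m)%N -> 0 <= t 0 l ->
  grid_point m (grid_floor m t) 0 l <= t 0 l <
  grid_point m (grid_floor m t) 0 l + m%:R^-1.
Proof.
move=> m0 t0; have m0' : (0 : R) < m%:R by rewrite ltr0n.
have /truncn_itv/andP[h1 h2] : 0 <= t 0 l * m%:R by rewrite mulr_ge0.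
rewrite mxE /grid_floor ler_pdivrMr// h1/=.
by rewrite -[X in _ + X]mul1r -mulrDl ltr_pdivlMr// natr1.
Qed.

Lemma grid_floor_dist N m (t : 'rV[R]_N) (l : 'I_N) : (0 < m)%N -> 0 <= t 0 l ->
  `|grid_point m (grid_floor m t) 0 l - t 0 l| <= m%:R^-1.
Proof.
move=> m0 t0; have /andP[h1 h2] := grid_floor_itv m0 t0.
have i0 : 0 <= m%:R^-1 :> R by rewrite invr_ge0.
by rewrite ler_norml; apply/andP; split; lra.
Qed.

Lemma grid_floor_le N m L (t : 'rV[R]_N) (l : 'I_N) : (0 < m)%N ->
  0 <= t 0 l <= L%:R -> (grid_floor m t l <= L * m)%N.
Proof.
move=> m0 /andP[t0 tL]; rewrite -(ler_nat R) natrM.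
have m0' : (0 : R) < m%:R by rewrite ltr0n.
have /truncn_itv/andP[h1 _] : 0 <= t 0 l * m%:R by rewrite mulr_ge0.
by apply: le_trans h1 _; rewrite ler_pM2r.
Qed.

(** Successive roundings of one point are parent and child in the grid, so the fine index determines
    both ends of a chaining step. *)
Lemma grid_floor_divn N m M (t : 'rV[R]_N) (l : 'I_N) : (0 < m)%N -> (0 < M)%N ->
  0 <= t 0 l -> (grid_floor (m * M) t l %/ M)%N = grid_floor m t l.
Proof.
move=> m0 M0 t0; apply/eqP; rewrite eqn_leq; apply/andP.
have M0' : (0 : R) < M%:R by rewrite ltr0n.
have := mulr_ge0 t0 (ler0n R m) => /truncn_itv; rewrite -/(grid_floor m t l) => /andP[h1 h2].
have := mulr_ge0 t0 (ler0n R (m * M)) => /truncn_itv; rewrite -/(grid_floor (m * M) t l) => /andP[h3 h4].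
move: h3 h4; rewrite natrM mulrA => h3 h4; split.
  rewrite -ltnS ltn_divLR// -(ltr_nat R) natrM; apply: le_lt_trans h3 _.
  by rewrite ltr_pM2r.
rewrite leq_divRL// -ltnS -(ltr_nat R) natrM; apply: le_lt_trans h4.
by rewrite ler_pM2r.
Qed.

(** Compactness of a cube; the free [m] gives approximations at arbitrarily late indices, where
    other errors are small as well. *)
Lemma bounded_cluster (D : finType) (L : R) (u : nat -> D -> R) :
  (forall n x, `|u n x| <= L) ->
  exists t : D -> R, forall (eta : R) (m : nat), 0 < eta ->
    exists2 n, (m <= n)%N & forall x, `|u n x - t x| < eta.
Proof.
move=> uL.
pose v n : 'rV[R]_#|D| := \row_i u n (enum_val i).
pose K := [set v : 'rV[R]_#|D| | forall i, `[- L, L]%classic (v ord0 i)].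
have cK : compact K 
  by apply: (@rV_compact _ _ (fun=> `[(- L), L]%classic)) => i; exact: segment_compact.
have vK : (v @ \oo) K.
  by exists 0%N => // n _ i; rewrite /= in_itv/= mxE -ler_norml.
have [t0 [_ clt]] := cK (v @ \oo) _ vK.
exists (fun x => t0 0 (enum_rank x)) => eta m eta0.
have Fm : (v @ \oo) [set v n | n in [set n | (m <= n)%N]].
  by exists m => // n /= mn; exists n.
have Bt : nbhs t0 (ball t0 eta) by exact: nbhsx_ballx.
have [_ [[n /= mn <-] bn]] := clt _ _ Fm Bt.
have bn' : forall a b, ball (t0 a b) eta (v n a b) := bn.2.
exists n => // x; have := bn' 0 (enum_rank x).
by rewrite mxE enum_rankK /ball/= distrC.
Qed.

Lemma within_orthant_cont (N d : nat) (f : 'rV[R]_N -> 'rV[R]_d) (t : 'rV[R]_N) (e : R) :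
  {within orthant R N, continuous f} -> orthant R N t -> 0 < e ->
  exists2 eta, 0 < eta & forall s, orthant R N s ->
    (forall l, `|s 0 l - t 0 l| < eta) -> forall i, `|f s 0 i - f t 0 i| < e.
Proof.
move=> /subspace_continuousP cf t0 e0.
have := cf t t0 => /(_ _ (nbhsx_ballx (f t) e e0)).
rewrite /= => /nbhs_ballP[eta /= eta0 h]; exists eta => // s s0 st i.
have /h/(_ s0) : ball t eta s.
  by split=> // a b; rewrite (ord1 a) /ball/= distrC; exact: st.
move=> h'; have : forall a b, ball (f t a b) e (f s a b) := h'.2.
by move/(_ 0 i); rewrite /ball/= distrC.
Qed.

(** With [z = 2 ^+ j], this is [z^n expR (- c z) <= C / z], read off from the term of degree [n.+1]
    of the exponential series. *)
Lemma exp_decay (c : R) (n : nat) : 0 < c -> exists2 C, 0 <= C & forall j : nat,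
  (2 ^+ (n * j)) * expR (- (c * 2 ^+ j)) <= C / 2 ^+ j.
Proof.
move=> c0; exists ((n.+1)`!%:R / c ^+ n.+1).
  by rewrite divr_ge0// exprn_ge0// ltW.
move=> j; set z : R := 2 ^+ j; have z0 : 0 < z by rewrite exprn_gt0.
have h := @expR_ge1Dxn R (c * z) n (mulr_ge0 (ltW c0) (ltW z0)).
have f0 : 0 < (n.+1)`!%:R :> R by rewrite ltr0n fact_gt0.
rewrite expRN ler_pdivrMr ?expR_gt0// mulnC exprM -/z.
apply: (@le_trans _ _ ((n.+1)`!%:R / c ^+ n.+1 / z * ((c * z) ^+ n.+1 / (n.+1)`!%:R))).
  rewrite le_eqVlt; apply/orP; left; apply/eqP; rewrite exprMn [z ^+ n.+1]exprSr; field.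
  by rewrite !gt_eqF// exprn_gt0.
apply: ler_wpM2l; last by apply: le_trans h; rewrite lerDr.
by rewrite !divr_ge0// ?exprn_ge0// ltW.
Qed.

End grids.

(** * Dyadic chaining of the sheet *)

Section chaining.
Context (disp : measure_display) (T : measurableType disp) (R : realType).
Variables (P : probability T R) (N d : nat) (B : 'rV[R]_N -> T -> 'rV[R]_d).
Hypothesis B_sheet : brownian_sheet P B.

Lemma measurable_sheet_diff (s t : 'rV[R]_N) (i : 'I_d) :
  orthant R N s -> orthant R N t ->
  measurable_fun setT (fun w => B s w 0 i - B t w 0 i).
Proof.
move=> s0 t0; have [ms _] := sheet_coord_gaussian B_sheet i s0.
by have [mt _] := sheet_coord_gaussian B_sheet i t0; exact: measurable_funB.
Qed.

Variables a b L : nat.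

(** Division by [2 ^ a] rounds the fine index down to its parent on the grid of level [j]. *)
Definition coarse_increment (j : nat) (g : 'I_N -> nat) (i : 'I_d) (w : T) : R :=
  B (grid_point R (2 ^ (a * j.+1)) g) w 0 i -
  B (grid_point R (2 ^ (a * j)) (fun l => g l %/ 2 ^ a)%N) w 0 i.

(** The threshold [2 ^- (b * j)] at mesh [2 ^- (a * j)] is a Hoelder bound of exponent [b / a]. *)
Definition large_increment (j : nat) : set T :=
  [set w | exists x : {ffun 'I_N -> 'I_(L * 2 ^ (a * j.+1)).+1} * 'I_d,
    2 ^- (b * j) <= `|coarse_increment j (fun l => x.1 l) x.2 w|].

Lemma measurable_large_increment j : measurable (large_increment j).
Proof.
apply: measurable_exists_fin => x; apply: measurable_norm_ge.
by apply: measurable_sheet_diff; exact: orthant_grid_point.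
Qed.

Lemma chaining_bound (n : nat) (w : T) (t : 'rV[R]_N) (i : 'I_d) : (0 < a)%N -> (0 < b)%N ->
  (forall j, (n <= j)%N -> ~ large_increment j w) ->
  (forall l, 0 <= t 0 l <= L%:R) ->
  `|B t w 0 i - B (grid_point R (2 ^ (a * n)) (grid_floor (2 ^ (a * n)) t)) w 0 i|
    <= 2 * 2 ^- (b * n).
Proof.
move=> a0 b0 nbad tL.
have t0 : orthant R N t by move=> l; case/andP: (tL l).
pose x j := B (grid_point R (2 ^ (a * j)) (grid_floor (2 ^ (a * j)) t)) w 0 i.
have m0 j : (0 < 2 ^ (a * j))%N by rewrite expn_gt0.
have step j : (n <= j)%N -> `|x j.+1 - x j| <= 2 ^- (b * j).
  move=> nj; rewrite leNgt; apply/negP => big; apply: (nbad j nj).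
  have gl l : (grid_floor (2 ^ (a * j.+1)) t l < (L * 2 ^ (a * j.+1)).+1)%N.
    by rewrite ltnS grid_floor_le.
  exists ([ffun l => Ordinal (gl l)], i) => /=; apply: le_trans (ltW big) _.
  rewrite le_eqVlt; apply/orP; left; apply/eqP; congr `|_|.
  rewrite /coarse_increment /x; congr (B _ w 0 i - B _ w 0 i).
    by apply/rowP => l; rewrite !mxE ffunE.
  apply/rowP => l; rewrite !mxE ffunE/=; congr (_%:R / _).
  by rewrite mulnS addnC expnD grid_floor_divn ?expn_gt0// t0.
(* The factor [1 - 2 ^- r] is the partial geometric sum that makes the induction close; [0 < b]
   gives the ratio 1/2. *)
have sumstep r : `|x (n + r)%N - x n| <= 2 * 2 ^- (b * n) * (1 - 2 ^- r).
  elim: r => [|r IH]; first by rewrite addn0 expr0 invr1 !subrr normr0 mulr0.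
  have -> : x (n + r.+1)%N - x n = (x (n + r).+1 - x (n + r)%N) + (x (n + r)%N - x n).
    by rewrite addnS; ring.
  apply: le_trans (ler_normD _ _) _.
  have h1 := step (n + r)%N (leq_addr _ _).
  have h2 : 2 ^- (b * (n + r)) <= 2 ^- (b * n) * 2 ^- r :> R.
    rewrite -invfM -exprD lef_pV2 ?posrE ?exprn_gt0// ler_eXn2l ?ltr1n//.
    by rewrite mulnDr leq_add2l leq_pmull.
  apply: le_trans (lerD (le_trans h1 h2) IH) _.
  have p0 : 2 ^+ r != 0 :> R by rewrite expf_neq0.
  have q0 : 2 ^+ (b * n) != 0 :> R by rewrite expf_neq0.
  by rewrite le_eqVlt; apply/orP; left; apply/eqP; rewrite exprS; field; rewrite p0.
apply/ler_addgt0Pr => e e0.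
have [eta eta0 heta] := within_orthant_cont (@sheet_continuous _ _ _ _ _ _ _ B_sheet w) t0 e0.
have [r hr] : exists r, (2 ^ (a * (n + r)))%:R^-1 < eta.
  pose r := (Num.truncn eta^-1).+1; exists r.
  rewrite invf_plt ?posrE ?ltr0n//; apply: lt_le_trans (truncnS_gt _) _.
  rewrite ler_nat; apply: leq_trans (ltnW (ltn_expl r (ltnSn 1))) _.
  by rewrite leq_exp2l// (leq_trans (leq_addl n r))// leq_pmull.
have := heta _ (orthant_grid_point _ (2 ^ (a * (n + r))) (grid_floor (2 ^ (a * (n + r))) t)).
move=> /(_ _ i) h.
have {}h : `|x (n + r)%N - B t w 0 i| < e.
  by apply: h => l; apply: le_lt_trans hr; rewrite grid_floor_dist// t0.
have -> : B t w 0 i - x n = - (x (n + r)%N - B t w 0 i) + (x (n + r)%N - x n) by ring.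
apply: le_trans (ler_normD _ _) _; rewrite normrN addrC lerD//; last exact: ltW.
apply: le_trans (sumstep r) _; rewrite ler_piMr// ?mulr_ge0 ?invr_ge0 ?exprn_ge0//.
Qed.

Lemma dist_grid_coarse (j : nat) (g : 'I_N -> nat) (l : 'I_N) :
  0 <= grid_point R (2 ^ (a * j.+1)) g 0 l -
    grid_point R (2 ^ (a * j)) (fun l => g l %/ 2 ^ a)%N 0 l <= (2 ^ (a * j))%:R^-1.
Proof.
rewrite !mxE mulnS addnC expnD.
set m := (2 ^ (a * j))%N; set M := (2 ^ a)%N.
have m0 : (0 : R) < m%:R by rewrite ltr0n expn_gt0.
have M0 : (0 : R) < M%:R by rewrite ltr0n expn_gt0.
have -> : (g l)%:R / (m * M)%:R - (g l %/ M)%:R / m%:R = (g l %% M)%:R / M%:R / m%:R :> R.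
  by rewrite {1}(divn_eq (g l) M) natrD !natrM; field; rewrite !gt_eqF.
rewrite !divr_ge0//= -[leRHS]mul1r ler_wpM2r ?invr_ge0//.
by rewrite ler_pdivrMr// mul1r ler_nat ltnW// ltn_mod expn_gt0.
Qed.

(** The variance is at most [D / 2 ^+ (a * j)] and the squared threshold is [2 ^- (2 * b * j)].
    Their ratio leaves [2 ^+ j] as [a = 2 b + 1], and a tail exponential in [2 ^+ j] beats the
    number of grid points. *)
Lemma large_increment_prob : (0 < L)%N -> a = (2 * b).+1 ->
  exists2 C, 0 <= C & forall j, (P (large_increment j) <= (C / 2 ^+ j)%:E)%E.
Proof.
move=> L0 aE.
(* The constant of [dist_prod_le], with [N.+1] for [N] to keep [D] positive. *)
pose D : R := N.+1%:R * L%:R ^+ N.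
have D0 : 0 < D by rewrite mulr_gt0 ?exprn_gt0 ?ltr0n.
have c0 : 0 < (4 * D)^-1 by rewrite invr_gt0 mulr_gt0.
have [C C0 hC] := exp_decay (a * N) c0.
exists (((2 * L * 2 ^ a) ^ N * d)%:R * Num.sqrt 2 * C) => [|j].
  by rewrite !mulr_ge0.
have p2 n : 0 < 2 ^+ n :> R by rewrite exprn_gt0.
have tail (x : {ffun 'I_N -> 'I_(L * 2 ^ (a * j.+1)).+1} * 'I_d) :
    (P [set w | (2 ^- (b * j) <= `|coarse_increment j (fun l => x.1 l) x.2 w|)%R] <=
      (Num.sqrt 2 * expR (- ((4 * D)^-1 * 2 ^+ j)))%:E)%E.
  have xL l : 0 <= grid_point R (2 ^ (a * j.+1)) (fun l => x.1 l) 0 l <= L%:R.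
    rewrite mxE divr_ge0//= ler_pdivrMr ?ltr0n ?expn_gt0// -natrM ler_nat.
    by rewrite -ltnS.
  have gd l := dist_grid_coarse j (fun l => x.1 l) l.
  have h := @sheet_increment_tail _ _ _ P N d B B_sheet _ _ x.2
    (orthant_grid_point _ (2 ^ (a * j)) (fun l => x.1 l %/ 2 ^ a)%N) _
    (D / 2 ^+ (a * j)) (2 ^- (b * j)) _ _ _.
  apply: le_trans (h (grid_point R (2 ^ (a * j.+1)) (fun l => x.1 l)) _ _ _ _) _.
  - by move=> l; have := gd l; rewrite subr_ge0 => /andP[].
  - apply: le_trans (ler_norm _) _; 
    apply: le_trans (@dist_prod_le _ _ _ _ L%:R (2 ^ (a * j))%:R^-1 _ _ _ _) _.
    + by rewrite ler1n.
    + by move=> l; case/andP: (xL l) => ? ?; rewrite ger0_norm.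
    + move=> l; have := orthant_grid_point R (2 ^ (a * j)) (fun l => x.1 l %/ 2 ^ a)%N l.
      case/andP: (xL l) => _ xl s0; rewrite ger0_norm//; apply: le_trans xl.
      by have := gd l; rewrite subr_ge0 => /andP[].
    + by move=> l; have /andP[g0 gl] := gd l; rewrite ger0_norm//; exact: gl.
    + rewrite natrX /D; apply: ler_wpM2r; first by rewrite invr_ge0 ltW.
      by apply: ler_wpM2r; [exact: exprn_ge0|rewrite ler_nat].
  - by rewrite divr_gt0.
  - by rewrite invr_gt0.
  rewrite lee_fin; apply: ler_wpM2l => //; rewrite ler_expR lerN2.
  rewrite le_eqVlt; apply/orP; left; apply/eqP.
  have -> : (a * j = b * j + b * j + j)%N by rewrite aE; lia.
  by rewrite !exprD; field; rewrite !(lt0r_neq0 (p2 _)) gt_eqF.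
apply: le_trans (probability_exists_le _ tail) _.
  move=> x; apply: measurable_norm_ge.
  by apply: measurable_sheet_diff; exact: orthant_grid_point.
rewrite lee_fin card_prod card_ffun !card_ord.
apply: (@le_trans _ _ (((2 * L * 2 ^ a) ^ N * d)%:R * Num.sqrt 2 *
    (2 ^+ (a * N * j) * expR (- ((4 * D)^-1 * 2 ^+ j))))).
  rewrite -[(_ ^ N * d)%:R * _ * _]mulrA [leRHS](_ : _ = ((2 * L * 2 ^ a) ^ N * d)%:R *
    2 ^+ (a * N * j) * (Num.sqrt 2 * expR (- ((4 * D)^-1 * 2 ^+ j)))); last by ring.
  apply: ler_wpM2r; first by rewrite mulr_ge0 ?expR_ge0.
  rewrite -natrX -natrM ler_nat mulnAC leq_mul2r; apply/orP; right.
  have -> : (2 ^ (a * N * j) = (2 ^ (a * j)) ^ N)%N by rewrite -expnM; congr (_ ^ _)%N; lia.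
  rewrite -expnMn; have [N0|N0] := posnP N; first by rewrite N0.
  rewrite leq_exp2r// mulnS expnD.
  have K0 : (0 < L * 2 ^ a * 2 ^ (a * j))%N by rewrite !muln_gt0 L0 !expn_gt0.
  by move: K0; rewrite -!mulnA; lia.
by rewrite -[leRHS]mulrA; apply: ler_wpM2l; rewrite ?mulr_ge0.
Qed.

End chaining.

(** * Tuples with a shared coordinate *)

Section admissible_tuples.
Variable R : realType.

Lemma inv_nat_lt (eta : R) : 0 < eta ->
  exists m, forall n, (m <= n)%N -> n.+1%:R^-1 < eta.
Proof.
move=> eta0; exists (Num.truncn eta^-1) => n mn.
rewrite invf_plt ?posrE ?ltr0n//; apply: lt_le_trans (truncnS_gt _) _.
by rewrite ler_nat ltnS.
Qed.

Lemma within_orthant_cont_fin (I : finType) (N d : nat) (f : 'rV[R]_N -> 'rV[R]_d)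
    (t : I -> 'rV[R]_N) (e : R) :
  {within orthant R N, continuous f} -> (forall p, orthant R N (t p)) -> 0 < e ->
  exists2 eta, 0 < eta & forall p s, orthant R N s ->
    (forall l, `|s 0 l - t p 0 l| < eta) -> forall i, `|f s 0 i - f (t p) 0 i| < e.
Proof.
move=> cf t0 e0.
have /choice[h hP] p : exists eta, 0 < eta /\ forall s, orthant R N s ->
    (forall l, `|s 0 l - t p 0 l| < eta) -> forall i, `|f s 0 i - f (t p) 0 i| < e.
  by have [eta eta0 etaP] := within_orthant_cont cf (t0 p) e0; exists eta.
exists (\big[Num.min/1]_p h p).
  by apply/bigmin_gtP; split=> // p _; have [] := hP p.
move=> p s s0 st; apply: (hP p).2 => // l; apply: lt_le_trans (st l) _.
exact: bigmin_le_cond.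
Qed.

Variables (k N : nat) (i j : 'I_k) (l : 'I_N).

(** All conditions are closed, so the admissible tuples form a compact set. Ellipticity stands in
    for the open conditions of positivity and distinctness. *)
Definition admissible (L nu : nat) (t : 'I_k -> 'rV[R]_N) : Prop :=
  [/\ forall p q, 0 <= t p 0 q <= L.+1%:R, t i 0 l = t j 0 l
    & forall a, nu.+1%:R^-1 * \sum_p a p ^+ 2 <= min_form t a].

Lemma admissible_closed (L nu : nat) (u : nat -> 'I_k -> 'rV[R]_N)
    (t : 'I_k -> 'rV[R]_N) :
  (forall n, admissible L nu (u n)) ->
  (forall (eta : R) (m : nat), 0 < eta ->
    exists2 n, (m <= n)%N & forall p q, `|u n p 0 q - t p 0 q| < eta) ->
  admissible L nu t.
Proof.
move=> uA ut.
have tL p q : 0 <= t p 0 q <= L.+1%:R.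
  apply/andP; split; apply/ler_addgt0Pr => e e0; have [n _ /(_ p q)] := ut e 0%N e0;
    by have [/(_ p q)/andP[? ?] _ _] := uA n; rewrite ltr_norml => /andP[? ?]; lra.
split=> //.
  apply/le_anti/andP; split; apply/ler_addgt0Pr => e e0;
    have [n _ h] := ut (e / 2) 0%N (divr_gt0 e0 (ltr0n R 2));
    have [_ ? _] := uA n; have := h i l; have := h j l; rewrite !ltr_norml => /andP[? ?] /andP[? ?]; lra.
move=> a; apply/ler_addgt0Pr => e e0.
set S := \sum_p a p ^+ 2; have S0 : 0 <= S by apply: sumr_ge0 => p _; exact: sqr_ge0.
pose C : R := k%:R * (N%:R * L.+1%:R ^+ N) * S.
have C0 : 0 <= C by rewrite /C !mulr_ge0// exprn_ge0.
have C1 : 0 < C + 1 by rewrite ltr_wpDl.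
have [n _ h] := ut (e / (C + 1)) 0%N (divr_gt0 e0 C1).
have [uL _ /(_ a)] := uA n; rewrite -/S => uS.
have lip := @min_form_lipschitz R k N (u n) t L.+1%:R (e / (C + 1)) _ uL tL
  (fun p q => ltW (h p q)) a.
have : `|min_form (u n) a - min_form t a| <= e.
  apply: le_trans (lip _) _; first by rewrite ler1n.
  rewrite -/S (_ : _ * S = C * (e / (C + 1))); last by rewrite /C; ring.
  by rewrite mulrCA ler_piMr ?(ltW e0)// ler_pdivrMr// mul1r lerDl.
rewrite ler_norml => /andP[_]; rewrite lerBlDl; exact: le_trans.
Qed.

End admissible_tuples.

(** * Measurability of the coincidence event *)

Section coincidence.
Context (disp : measure_display) (T : measurableType disp) (R : realType).
Variables (P : probability T R) (N d k : nat) (B : 'rV[R]_N -> T -> 'rV[R]_d).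
Hypothesis B_sheet : brownian_sheet P B.
Variables (i j : 'I_k) (l : 'I_N) (L nu : nat).

Definition coincidence : set T := [set w | exists2 t, admissible i j l L nu t
  & forall p q, B (t p) w = B (t q) w].

Let sheet_cont := @sheet_continuous _ _ _ _ _ _ _ B_sheet.

Lemma admissible_orthant (t : 'I_k -> 'rV[R]_N) p :
  admissible i j l L nu t -> orthant R N (t p).
Proof. by move=> [tL _ _] q; case/andP: (tL p q). Qed.

Let grid_tuple r (G : {ffun 'I_k -> {ffun 'I_N -> 'I_(L.+1 * r.+1).+1}}) p :
  'rV[R]_N := grid_point R r.+1 (fun q => G p q).

Let approximate e r (G : {ffun 'I_k -> {ffun 'I_N -> 'I_(L.+1 * r.+1).+1}}) : set T :=
  [set w | (exists2 t, admissible i j l L nu t &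
      forall p q, `|grid_tuple G p 0 q - t p 0 q| <= r.+1%:R^-1) /\
    forall x : 'I_k * 'I_k * 'I_d,
      `|B (grid_tuple G x.1.1) w 0 x.2 - B (grid_tuple G x.1.2) w 0 x.2| <= e.+1%:R^-1].

(* [P] is unspecified on non-measurable sets, so the uncountable union over
   tuples has to be reduced to countably many grid tuples. *)
Let coincidence_approximate :
  coincidence = \bigcap_e \bigcup_r [set w | exists G, @approximate e (e + r)%N G w].
Proof.
apply/seteqP; split => w /=.
  move=> [t At Bt] e _.
  have t0 p := admissible_orthant p At; have [tL _ _] := At.
  have e0 : 0 < e.+1%:R^-1 / 2 :> R by rewrite divr_gt0// invr_gt0 ltr0n.
  have [eta eta0 heta] := within_orthant_cont_fin (@sheet_cont w) t0 e0.
  have [r hr] := inv_nat_lt eta0; exists r => //=; set m := (e + r).+1.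
  have tm p q : (grid_floor m (t p) q < (L.+1 * m).+1)%N by rewrite ltnS grid_floor_le.
  exists [ffun p => [ffun q => Ordinal (tm p q)]].
  have GE p : grid_tuple [ffun p => [ffun q => Ordinal (tm p q)]] p =
      grid_point R m (grid_floor m (t p)).
    by apply/rowP => q; rewrite !mxE !ffunE.
  have Gd p q : `|grid_point R m (grid_floor m (t p)) 0 q - t p 0 q| <= m%:R^-1.
    by apply: grid_floor_dist => //; exact: t0.
  split.
    by exists t => // p q; rewrite GE.
  move=> [[p q] c] /=; rewrite !GE.
  have h p' : `|B (grid_point R m (grid_floor m (t p'))) w 0 c - B (t p') w 0 c|
      < e.+1%:R^-1 / 2.
    apply: heta; first exact: orthant_grid_point.
    by move=> q'; apply: le_lt_trans (Gd _ _) _; apply: hr; exact: leq_addl.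
  have := h p; have := h q; rewrite (Bt p q) !ltr_norml ler_norml.
  move: (e.+1%:R^-1) => z.
  by move=> /andP[? ?] /andP[? ?]; apply/andP; split; lra.
move=> wA.
(* Level [e + r] is at least [e], so the mesh tends to 0 with the tolerance although [r] is
   uncontrolled. A limit point of the admissible tuples is then a coincidence, by continuity of the
   path. *)
have /choice[f fP] e : exists tt : ('I_k -> 'rV[R]_N) * ('I_k -> 'rV[R]_N),
    [/\ admissible i j l L nu tt.1, forall p, orthant R N (tt.2 p),
      forall p q, `|tt.2 p 0 q - tt.1 p 0 q| <= e.+1%:R^-1 &
      forall p q c, `|B (tt.2 p) w 0 c - B (tt.2 q) w 0 c| <= e.+1%:R^-1].
  have [r _ [G [[t At Gt] GB]]] := wA e I.
  exists (t, grid_tuple G); split => //=.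
  - by move=> p; exact: orthant_grid_point.
  - move=> p q; apply: le_trans (Gt p q) _.
    by rewrite lef_pV2 ?posrE ?ltr0n// ler_nat ltnS leq_addr.
  - by move=> p q c; exact: (GB (p, q, c)).
have [|t0 ht0] := @bounded_cluster R ('I_k * 'I_N)%type L.+1%:R
    (fun n x => (f n).1 x.1 0 x.2).
  by move=> n x; have [[/(_ x.1 x.2)/andP[? ?] _ _] _ _ _] := fP n; rewrite ger0_norm.
pose t p : 'rV[R]_N := \row_q t0 (p, q).
have ht (eta : R) (m : nat) : 0 < eta ->
    exists2 n, (m <= n)%N & forall p q, `|(f n).1 p 0 q - t p 0 q| < eta.
  by move=> /(ht0 eta m)[n mn h]; exists n => // p q; rewrite mxE; exact: (h (p, q)).
have At : admissible i j l L nu t.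
  by apply: (admissible_closed (u := fun n => (f n).1)) => // n; have [] := fP n.
exists t => // p q; apply/rowP => c.
apply/eqP; rewrite -subr_eq0 -normr_le0; apply/ler_addgt0Pr => e e0; rewrite add0r.
have e3 : 0 < e / 3 by rewrite divr_gt0.
have [eta eta0 heta] := within_orthant_cont_fin (@sheet_cont w)
  (fun p => admissible_orthant p At) e3.
have eta2 : 0 < eta / 2 by rewrite divr_gt0.
have [m1 hm1] := inv_nat_lt eta2; have [m2 hm2] := inv_nat_lt e3.
have [n mn hn] := ht (eta / 2) (maxn m1 m2) eta2.
have [_ s0 sd sB] := fP n.
have n1 := hm1 n (leq_trans (leq_maxl _ _) mn).
have n2 := hm2 n (leq_trans (leq_maxr _ _) mn).
move: (n.+1%:R^-1 : R) n1 n2 sd sB => z n1 n2 sd sB.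
have h p' : `|B ((f n).2 p') w 0 c - B (t p') w 0 c| < e / 3.
  apply: heta => // q'; rewrite -(subrKA ((f n).1 p' 0 q')).
  apply: le_lt_trans (ler_normD _ _) _.
  by have := hn p' q'; have := sd p' q'; lra.
have := h p; have := h q; have := sB p q c; rewrite !ltr_norml !ler_norml.
by move=> /andP[? ?] /andP[? ?] /andP[? ?]; apply/andP; split; lra.
Qed.

Lemma measurable_coincidence : measurable coincidence.
Proof.
rewrite coincidence_approximate; apply: bigcapT_measurable => e.
apply: bigcupT_measurable => r; apply: measurable_exists_fin => G.
rewrite /approximate; set near_adm := (exists2 t, _ & _).
(* [near_adm] does not involve [w]: the event is empty or a finite intersection. *)
have [adm|nadm] := pselect near_adm; last first.
  rewrite [X in measurable X](_ : _ = set0)//.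
  by apply/seteqP; split => w //= -[].
rewrite [X in measurable X](_ : _ = [set w | forall x : 'I_k * 'I_k * 'I_d,
  `|B (grid_tuple G x.1.1) w 0 x.2 - B (grid_tuple G x.1.2) w 0 x.2| <= e.+1%:R^-1]); last first.
  by apply/seteqP; split => w /=; [case|].
apply: measurable_forall_fin => x; apply: measurable_norm_le.
by apply: (measurable_sheet_diff B_sheet); exact: orthant_grid_point.
Qed.

End coincidence.

(** * Union bound over the cells of tuples with a shared coordinate *)

Section null_coincidence.
Context (disp : measure_display) (T : measurableType disp) (R : realType).
Variables (P : probability T R) (N d k : nat) (B : 'rV[R]_N -> T -> 'rV[R]_d).
Hypothesis B_sheet : brownian_sheet P B.
Variables (i j : 'I_k.+1) (l : 'I_N) (L nu : nat).
Hypothesis neq_ij : i != j.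

Let D := {x : 'I_k.+1 * 'I_N | x != (j, l)}.

Let il_neq : (i, l) != (j, l).
Proof. by rewrite xpair_eqE eqxx andbT. Qed.

(* The [l]-th coordinates of points [i] and [j] agree, so coordinate [(j, l)]
   is read off at [(i, l)]. *)
Let shared_index (x : 'I_k.+1 * 'I_N) : D := insubd (Sub (i, l) il_neq : D) x.

Let card_D : #|{: D}| = (k.+1 * N).-1.
Proof.
rewrite card_sig -[in RHS](card_ord k.+1) -[in RHS](card_ord N) -card_prod.
by rewrite (eq_card (B := predC1 (j, l)))// cardC1.
Qed.

Let cell m (u : {ffun D -> 'I_(L.+1 * m).+1}) (p : 'I_k.+1) : 'rV[R]_N :=
  grid_point R m (fun q => u (shared_index (p, q))).

(** Equal coordinates have equal floors, so rounding respects the shared coordinate and the free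
    indices in [D] suffice. *)
Lemma cell_cover m (t : 'I_k.+1 -> 'rV[R]_N) : (0 < m)%N ->
  (forall p q, 0 <= t p 0 q <= L.+1%:R) -> t i 0 l = t j 0 l ->
  exists u, forall p, @cell m u p = grid_point R m (grid_floor m (t p)).
Proof.
move=> m0 tL tij.
have lt_x (x : D) : (grid_floor m (t (val x).1) (val x).2 < (L.+1 * m).+1)%N.
  by rewrite ltnS grid_floor_le.
exists [ffun x => Ordinal (lt_x x)] => p; apply/rowP => q; rewrite !mxE ffunE/=.
rewrite /shared_index val_insubd; case: ifPn => //=.
by rewrite negbK => /eqP[-> ->]; rewrite /grid_floor tij.
Qed.

Hypothesis N0 : (0 < N)%N.
Hypothesis critical : (k * d = 2 * k.+1 * N)%N.

Lemma coincidence_null : P (coincidence B i j l L nu) = 0%E.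
Proof.
(* Up to constants, [2 ^ (a (b - 1) n)] cells with a small ball probability
   [2 ^ - (b n (2 b))] each: the union bound is [2 ^ - ((b + 1) n)]. *)
pose b := (k.+1 * N)%N; pose a := (2 * b).+1.
have b0 : (0 < b)%N by rewrite muln_gt0.
have kdE : (k * d = 2 * b)%N by rewrite critical mulnA.
have [C1 C10 hC1] := large_increment_prob B_sheet (ltn0Sn L) (erefl a : a = (2 * b).+1).
(* Half of the ellipticity constant is given up for rounding to the grid. *)
pose lam : R := nu.+1%:R^-1 / 2.
have lam0 : 0 < lam by rewrite divr_gt0// invr_gt0 ltr0n.
(* The 4 is twice the chaining constant 2, one error for each of the two points compared. [K] is
   fixed before the cell and [n]. *)
have [K K0 hK] := small_ball ('I_k * 'I_d)%type lam0 (ltr0n R 4).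
pose bad n := \bigcup_(j0 in [set j0 | (n <= j0)%N]) large_increment B a b L.+1 j0.
have mbad n : measurable (bad n).
  by apply: bigcup_measurable => j0 _; exact: (measurable_large_increment B_sheet).
pose m n := (2 ^ (a * n))%N.
have m0 n : (0 < m n)%N by rewrite expn_gt0.
(* A deterministic condition: cells that violate it give the empty event, so [PA] can hold for every
   cell. *)
pose definite n (u : {ffun D -> 'I_(L.+1 * m n).+1}) :=
  forall c, lam * \sum_p c p ^+ 2 <= min_form (cell u) c.
pose A n (u : {ffun D -> 'I_(L.+1 * m n).+1}) : set T := [set w | definite n u /\
  forall x : 'I_k * 'I_d, `|B (cell u (lift ord0 x.1)) w 0 x.2 - B (cell u ord0) w 0 x.2|
    <= 4 / (2 ^ (b * n))%:R].
have mdiff n (u : {ffun D -> 'I_(L.+1 * m n).+1}) (x : 'I_k * 'I_d) :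
    measurable_fun setT (fun w => B (cell u (lift ord0 x.1)) w 0 x.2 - B (cell u ord0) w 0 x.2).
  by apply: (measurable_sheet_diff B_sheet); exact: orthant_grid_point.
have mA n u : measurable (A n u).
  have [def|ndef] := pselect (definite n u); last first.
    rewrite [X in measurable X](_ : _ = set0)//.
    by apply/seteqP; split => w //= -[].
  rewrite [X in measurable X](_ : _ = [set w | forall x : 'I_k * 'I_d,
    `|B (cell u (lift ord0 x.1)) w 0 x.2 - B (cell u ord0) w 0 x.2| <= 4 / (2 ^ (b * n))%:R]).
    by apply: measurable_forall_fin => x; apply: measurable_norm_le; exact: mdiff.
  by apply/seteqP; split => w /=; [case|].
have PA n u : (P (A n u) <= (K / (2 ^ (b * n))%:R ^+ (k * d))%:E)%E.
  have [def|ndef] := pselect (definite n u); last first.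
    rewrite [X in P X](_ : _ = set0); last by apply/seteqP; split => w //= -[].
    by rewrite measure0 lee_fin divr_ge0// exprn_ge0.
  have h := hK _ _ P (fun x w => B (cell u (lift ord0 x.1)) w 0 x.2 - B (cell u ord0) w 0 x.2)
    (mdiff n u) (sheet_cos_le B_sheet (ltW lam0)
      (fun p => orthant_grid_point _ _ _) def) (2 ^ (b * n))%N.
  have {}h : (0 < 2 ^ (b * n))%N -> _ := h; rewrite card_prod !card_ord in h.
  apply: le_trans (h _); last by rewrite expn_gt0.
  apply: le_measure; rewrite ?inE//.
  - by apply: measurable_forall_fin => x; apply: measurable_norm_le; exact: mdiff.
  - by move=> w [].
pose C2 : R := (2 * L.+1)%:R ^+ b.-1 * K.
have C20 : 0 <= C2 by rewrite mulr_ge0// exprn_ge0.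
have PU n : (P [set w | exists u, A n u w] <= (C2 / 2 ^+ n)%:E)%E.
  apply: le_trans (probability_exists_le (mA n) (PA n)) _.
  rewrite lee_fin card_ffun card_D card_ord -/b kdE.
  (* In exponents, [2 b^2 = (2 b + 1) (b - 1) + (b + 1)]. *)
  have mE : ((2 ^ (b * n)) ^ (2 * b) = m n ^ b.-1 * 2 ^ ((b + 1) * n))%N.
    rewrite /m -!expnM -expnD; congr (2 ^ _)%N.
    rewrite /a -(prednK b0) /=; ring.
  apply: (@le_trans _ _ ((2 * L.+1 * m n)%:R ^+ b.-1 * (K / (2 ^ (b * n))%:R ^+ (2 * b)))).
    apply: ler_wpM2r; first by rewrite divr_ge0// exprn_ge0.
    have powle (x y e : nat) : (x <= y)%N -> (x ^ e <= y ^ e)%N.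
      by case: e => // e xy; rewrite leq_exp2r.
    rewrite -natrX ler_nat; apply: powle.
    have : (0 < L.+1 * m n)%N by rewrite muln_gt0 m0.
    by rewrite -!mulnA; lia.
  have E2 : (2 ^ (b * n))%:R ^+ (2 * b) = (m n)%:R ^+ b.-1 * 2 ^+ ((b + 1) * n) :> R.
    by rewrite -natrX mE natrM (natrX _ (m n)) (natrX _ 2).
  have mn0 : 0 < (m n)%:R ^+ b.-1 :> R by rewrite exprn_gt0// ltr0n m0.
  have p2 (e : nat) : 0 < 2 ^+ e :> R by rewrite exprn_gt0.
  rewrite E2 natrM exprMn.
  rewrite [leLHS](_ : _ = C2 / 2 ^+ ((b + 1) * n)); last first.
    by rewrite /C2; field; rewrite (gt_eqF mn0) (gt_eqF (p2 _)).
  rewrite ler_wpM2l// lef_pV2 ?posrE ?p2// ler_eXn2l ?ltr1n//.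
  by rewrite leq_pmull// addn1.
have cover : exists n0, forall n, (n0 <= n)%N ->
    coincidence B i j l L nu `<=` bad n `|` [set w | exists u, A n u w].
  (* [Cl] is the Lipschitz constant of the form. From [n0] on, rounding changes the form by at most
     [lam] times the sum of squares, which leaves [lam] out of [2 lam]. *)
  pose Cl : R := k.+1%:R * (N%:R * L.+1%:R ^+ N).
  have Cl0 : 0 <= Cl by rewrite !mulr_ge0// exprn_ge0.
  have lamC : 0 < lam / (Cl + 1) by rewrite divr_gt0// ltr_wpDl.
  have [n0 hn0] := inv_nat_lt lamC; exists n0 => n n0n w [t [tL tij tdef] Bt].
  have [?|nbad] := pselect (bad n w); [by left|right].
  have [u uE] := cell_cover (m0 n) tL tij; exists u.
  have t0 p q : 0 <= t p 0 q by case/andP: (tL p q).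
  have ud p q : `|t p 0 q - cell u p 0 q| <= (m n)%:R^-1.
    by rewrite uE distrC; apply: grid_floor_dist => //; exact: m0.
  have uL p q : 0 <= cell u p 0 q <= L.+1%:R.
    rewrite orthant_grid_point/= uE; apply: le_trans (_ : t p 0 q <= _).
      by have /andP[] := grid_floor_itv (m0 n) (t0 p q).
    by case/andP: (tL p q).
  split=> [c|[p c] /=].
    have lip := @min_form_lipschitz R k.+1 N t (cell u) L.+1%:R _ _ tL uL ud c.
    have {}lip : `|min_form t c - min_form (cell u) c| <= lam * \sum_p c p ^+ 2.
      apply: le_trans (lip _) _; first by rewrite ler1n.
      apply: ler_wpM2r; first by apply: sumr_ge0 => p _; exact: sqr_ge0.
      rewrite mulrA -/Cl; have mn : (m n)%:R^-1 < lam / (Cl + 1).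
        apply: le_lt_trans (hn0 n n0n); rewrite lef_pV2 ?posrE ?ltr0n// ler_nat.
        apply: leq_trans (ltn_expl n (ltnSn 1)) _; rewrite leq_exp2l//.
        by rewrite leq_pmull.
      apply: le_trans (ler_wpM2l Cl0 (ltW mn)) _.
      by rewrite mulrCA ler_piMr ?(ltW lam0)// ler_pdivrMr ?ltr_wpDl// mul1r lerDl.
    have := tdef c; rewrite (_ : nu.+1%:R^-1 = lam + lam); last by rewrite /lam; field.
    by move: lip; rewrite mulrDl ler_norml => /andP[? ?] ?; lra.
  have h p' : `|B (t p') w 0 c - B (cell u p') w 0 c| <= 2 * 2 ^- (b * n).
    rewrite uE; apply: (chaining_bound B_sheet (L := L.+1)) => // j0 nj0 badj.
    by apply: nbad; exists j0.
  have := h (lift ord0 p); have := h ord0; rewrite (Bt (lift ord0 p) ord0) natrX.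
  move: (2 ^- (b * n) : R) => z.
  by rewrite !ler_norml => /andP[? ?] /andP[? ?]; apply/andP; split; lra.
have [n0 hn0] := cover.
have mE := measurable_coincidence B_sheet i j l L nu.
have PE n : (n0 <= n)%N -> (P (coincidence B i j l L nu) <= ((2 * C1 + C2) / 2 ^+ n)%:E)%E.
  move=> n0n; apply: (@le_trans _ _ (P (bad n `|` [set w | exists u, A n u w]))).
    apply: le_measure; rewrite ?inE//; last exact: hn0.
    by apply: measurableU => //; apply: measurable_exists_fin => u; exact: mA.
  apply: le_trans (@measureU2 _ _ _ P _ _ (mbad n) _) _.
    by apply: measurable_exists_fin => u; exact: mA.
  rewrite mulrDl EFinD; apply: leeD; last exact: PU.
  apply: probability_tail_le => // j0.
  exact: (measurable_large_increment B_sheet).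
apply/eqP; rewrite eq_le measure_ge0 andbT.
rewrite -[P _]fineK ?fin_num_measure//.
set p := fine _; rewrite lee_fin leNgt; apply/negP => p0.
(* Adding 1 keeps the divisor positive; [2 ^ n > n] reduces the decay of [2 ^- n] to that of the
   inverse integers. *)
have [m1 hm1] := @inv_nat_lt R (p / (2 * C1 + C2 + 1)) ltac:(by rewrite divr_gt0// ltr_wpDl// addr_ge0// mulr_ge0).
have := PE _ (leq_maxl n0 m1); rewrite -[P _]fineK ?fin_num_measure// lee_fin -/p.
apply/negP; rewrite -ltNge.
have h := hm1 _ (leq_maxr n0 m1).
have h2 : (2 ^+ maxn n0 m1)^-1 <= (maxn n0 m1).+1%:R^-1 :> R.
  by rewrite lef_pV2 ?posrE ?exprn_gt0 ?ltr0n// -natrX ler_nat ltn_expl.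
have S0 : 0 < 2 * C1 + C2 + 1 by rewrite ltr_wpDl// addr_ge0// mulr_ge0.
apply: (@le_lt_trans _ _ ((2 * C1 + C2 + 1) * (2 ^+ maxn n0 m1)^-1)).
  by rewrite ler_wpM2r ?invr_ge0 ?exprn_ge0// lerDl.
by rewrite mulrC -ltr_pdivlMr//; exact: le_lt_trans h2 h.
Qed.

End null_coincidence.

Theorem theorem1p3 (R : realType) (disp : measure_display)
    (T : measurableType disp) (P : probability T R) (N d k : nat)
    (N_ge1 : (1 <= N)%N) (d_ge1 : (1 <= d)%N) (k_ge1 : (1 <= k)%N)
    (critical : ((k - 1) * d = 2 * k * N)%N)
    (i j : 'I_k) (lt_ij : (i < j)%N) (l : 'I_N)
    (B : 'rV[R]_N -> T -> 'rV[R]_d) (B_sheet : brownian_sheet P B) :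
  P [set w | exists t : 'I_k -> 'rV[R]_N,
      [/\ shared_coord R N k i j l t, injective t
        & forall p q : 'I_k, B (t p) w = B (t q) w]] = 0%E.
Proof.
case: k k_ge1 critical i j lt_ij => // k _; rewrite subn1/= => critical i j lt_ij.
have neq_ij : i != j by rewrite -val_eqE neq_ltn lt_ij.
pose E L nu := coincidence B i j l L nu.
have mE L nu : measurable (E L nu) by exact: (measurable_coincidence B_sheet).
have null L nu : P (E L nu) = 0%E by exact: (coincidence_null B_sheet).
(* The inclusion of the event in the union uses [min_form_definite], the reverse one
   [min_form_definite_inj]. *)
rewrite [X in P X](_ : _ = \bigcup_L \bigcup_nu E L nu); last first.
  apply/seteqP; split => w /=.
    move=> [t [[t0 tij] injt Bt]].
    have [c c0 tc] := min_form_definite t0 injt.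
    have [nu hnu] := inv_nat_lt c0.
    (* The largest integer part of a coordinate; every coordinate is then below [L.+1]. *)
    pose L := \max_(x : 'I_k.+1 * 'I_N) (Num.truncn (t x.1 0%R x.2)).
    exists L => //; exists nu => //; exists t => //; split => //.
      move=> p q; rewrite (ltW (t0 p q))/=; apply: le_trans (ltW (truncnS_gt _)) _.
      by rewrite ler_nat ltnS; exact: (leq_bigmax (p, q)).
    move=> a; apply: le_trans (tc a); apply: ler_wpM2r; last exact: ltW (hnu _ _).
    by apply: sumr_ge0 => p _; exact: sqr_ge0.
  move=> [L _ [nu _ [t [tL tij tdef] Bt]]]; exists t.
  have nu0 : 0 < nu.+1%:R^-1 :> R by rewrite invr_gt0 ltr0n.
  have [injt t0] := min_form_definite_inj nu0
    (fun p q => proj1 (andP (tL p q))) tdef.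
  by split.
have null_bigcup (F : nat -> set T) : (forall n, measurable (F n)) ->
    (forall n, P (F n) = 0%E) -> P (\bigcup_n F n) = 0%E.
  move=> mF F0; apply/eqP; rewrite eq_le measure_ge0 andbT.
  have mU : measurable (\bigcup_n F n) by exact: bigcup_measurable.
  apply: le_trans (@measure_sigma_subadditive _ _ _ P _ _ mF mU (fun w h => h)) _.
  by rewrite eseries0// => n _ _; exact: F0.
apply: (null_bigcup) => L; first by exact: bigcup_measurable.
by apply: null_bigcup.
Qed.
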